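(* Let $R$ be a Gorenstein ring and let $I$ be a perfect Gorenstein ideal of $R$ of codimension three. Then $I$ is generically a complete intersection if and only if $$I^2\colon I = I .$$
   Context: All rings are commutative and Noetherian. For ideals $A,B$ of $R$, $A\colon B=\{r\in R : rB\subseteq A\}$. A perfect Gorenstein ideal of codimension three is an ideal $I$ of height three such that $R/I$ is a perfect $R$-module (its projective dimension equals the grade of $I$, here three) and $R/I$ is a Gorenstein ring. The ideal $I$ is generically a complete intersection if $I_{\mathfrak p}$ is generated by an $R_{\mathfrak p}$-regular sequence for every minimal prime $\mathfrak p$ of $I$. *)

(* Defs.v *)
From HB Require Import structures.
From mathcomp Require Import all_boot all_order all_algebra.
From mathcomp Require Import ring_quotient generic_quotient.
From mathcomp Require Import boolp classical_sets.
From mathcomp Require Import ring.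

Set Implicit Arguments.
Unset Strict Implicit.
Unset Printing Implicit Defensive.

Import GRing.Theory.
Local Open Scope ring_scope.
Local Open Scope quotient_scope.
Local Open Scope classical_set_scope.

(* Proper ideals are the boolean predicates [idealr R], prime ideals are the
   [prime_idealr R]; with the classical axioms of boolp every proper (prime)
   ideal has this form.  Ideals that may be the unit ideal are of type [set R]. *)

(** Localization of R at a prime p: fractions a/s with s outside p, where
    a/s = b/t iff u (a t - b s) = 0 for some u outside p. *)
Module Localization.
Section Localization.
Variables (R : comNzRingType) (p : prime_idealr R).
Implicit Types a b s t : R.

Definition frac := {x : R * R | x.2 \notin p}.
HB.instance Definition _ := Choice.on frac.

Definition num (x : frac) : R := (val x).1.
Definition den (x : frac) : R := (val x).2.
Implicit Types x y z : frac.

Lemma den_notin x : den x \notin p. Proof. exact: (valP x). Qed.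

Lemma notinM s t : s \notin p -> t \notin p -> s * t \notin p.
Proof. by rewrite prime_idealrM negb_or => -> ->. Qed.

Lemma notin1 : 1 \notin p. Proof. by rewrite idealr1. Qed.

Definition mkfrac a s (sp : s \notin p) : frac :=
  exist (fun x : R * R => x.2 \notin p) (a, s) sp.

Definition equiv x y : bool :=
  `[< exists2 u, u \notin p & u * (num x * den y - num y * den x) = 0 >].

Lemma equiv_refl : reflexive equiv.
Proof. by move=> x; apply/asboolP; exists 1; rewrite ?notin1 ?subrr ?mulr0. Qed.

Lemma equiv_sym : symmetric equiv.
Proof.
move=> x y; apply/asboolP/asboolP => -[u up e]; exists u => //;
by rewrite -opprB mulrN e oppr0.
Qed.

Lemma equiv_trans : transitive equiv.
Proof.
move=> y x z /asboolP[u up e] /asboolP[v vp f]; apply/asboolP.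
exists (u * v * den y); first by rewrite !notinM ?den_notin.
transitivity (v * den z * (u * (num x * den y - num y * den x))
  + u * den x * (v * (num y * den z - num z * den y))); first by ring.
by rewrite e f !mulr0 addr0.
Qed.

Canonical equiv_equiv := EquivRel equiv equiv_refl equiv_sym equiv_trans.

Definition type := {eq_quot equiv}.
HB.instance Definition _ : EqQuotient _ equiv type := EqQuotient.on type.
HB.instance Definition _ := Choice.on type.

Lemma eq_pi x y u : u \notin p -> u * (num x * den y - num y * den x) = 0 ->
  \pi_type x = \pi_type y.
Proof. by move=> up e; apply/eqmodP/asboolP; exists u. Qed.

Lemma repr_pi x : exists2 u, u \notin p &
  u * (num x * den (repr (\pi_type x)) - num (repr (\pi_type x)) * den x) = 0.
Proof.
have /eqmodP/asboolP : x = repr (\pi_type x) %[mod type] by rewrite reprK.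
by [].
Qed.

Definition addf x y : frac :=
  mkfrac (num x * den y + num y * den x) (notinM (den_notin x) (den_notin y)).
Definition oppf x : frac := mkfrac (- num x) (den_notin x).
Definition mulf x y : frac :=
  mkfrac (num x * num y) (notinM (den_notin x) (den_notin y)).

Definition tofrac a : type := \pi_type (mkfrac a notin1).
Definition add := lift_op2 type addf.
Definition opp := lift_op1 type oppf.
Definition mul := lift_op2 type mulf.

Lemma pi_add : {morph \pi : x y / addf x y >-> add x y}.
Proof.
move=> x y; unlock add.
have [u up e] := repr_pi x; have [v vp f] := repr_pi y.
set x' := repr (\pi_type x) in e *; set y' := repr (\pi_type y) in f *.
apply: (eq_pi (notinM up vp)); rewrite /addf /mkfrac /num /den /=.
rewrite -/(num x) -/(num y) -/(den x) -/(den y).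
rewrite -/(num x') -/(num y') -/(den x') -/(den y').
transitivity (v * den y * den y' * (u * (num x * den x' - num x' * den x))
  + u * den x * den x' * (v * (num y * den y' - num y' * den y))); first by ring.
by rewrite e f !mulr0 addr0.
Qed.
Canonical pi_add_morph := PiMorph2 pi_add.

Lemma pi_opp : {morph \pi : x / oppf x >-> opp x}.
Proof.
move=> x; unlock opp; have [u up e] := repr_pi x.
set x' := repr (\pi_type x) in e *.
apply: (eq_pi up); rewrite /oppf /mkfrac /num /den /=.
rewrite -/(num x) -/(den x) -/(num x') -/(den x').
transitivity (- (u * (num x * den x' - num x' * den x))); first by ring.
by rewrite e oppr0.
Qed.
Canonical pi_opp_morph := PiMorph1 pi_opp.

Lemma pi_mul : {morph \pi : x y / mulf x y >-> mul x y}.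
Proof.
move=> x y; unlock mul.
have [u up e] := repr_pi x; have [v vp f] := repr_pi y.
set x' := repr (\pi_type x) in e *; set y' := repr (\pi_type y) in f *.
apply: (eq_pi (notinM up vp)); rewrite /mulf /mkfrac /num /den /=.
rewrite -/(num x) -/(num y) -/(den x) -/(den y).
rewrite -/(num x') -/(num y') -/(den x') -/(den y').
transitivity (v * num y * den y' * (u * (num x * den x' - num x' * den x))
  + u * num x' * den x * (v * (num y * den y' - num y' * den y))); first by ring.
by rewrite e f !mulr0 addr0.
Qed.
Canonical pi_mul_morph := PiMorph2 pi_mul.

Lemma eq_pi1 x y : num x * den y = num y * den x -> \pi_type x = \pi_type y.
Proof. by move=> e; apply: (eq_pi notin1); rewrite e subrr mulr0. Qed.

Lemma addA : associative add.
Proof.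
elim/quotW=> x; elim/quotW=> y; elim/quotW=> z; rewrite -!pi_add.
by apply: eq_pi1; rewrite /addf /mkfrac /num /den /=; ring.
Qed.

Lemma addC : commutative add.
Proof.
elim/quotW=> x; elim/quotW=> y; rewrite -!pi_add.
by apply: eq_pi1; rewrite /addf /mkfrac /num /den /=; ring.
Qed.

Lemma add0 : left_id (tofrac 0) add.
Proof.
elim/quotW=> x; rewrite -!pi_add.
by apply: eq_pi1; rewrite /addf /mkfrac /num /den /=; ring.
Qed.

Lemma addN : left_inverse (tofrac 0) opp add.
Proof.
elim/quotW=> x; rewrite -!pi_opp -!pi_add.
by apply: eq_pi1; rewrite /addf /mkfrac /num /den /=; ring.
Qed.

HB.instance Definition _ := GRing.isZmodule.Build type addA addC add0 addN.

Lemma mulA : associative mul.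
Proof.
elim/quotW=> x; elim/quotW=> y; elim/quotW=> z; rewrite -!pi_mul.
by apply: eq_pi1; rewrite /mulf /mkfrac /num /den /=; ring.
Qed.

Lemma mulC : commutative mul.
Proof.
elim/quotW=> x; elim/quotW=> y; rewrite -!pi_mul.
by apply: eq_pi1; rewrite /mulf /mkfrac /num /den /=; ring.
Qed.

Lemma mul1 : left_id (tofrac 1) mul.
Proof.
elim/quotW=> x; rewrite -!pi_mul.
by apply: eq_pi1; rewrite /mulf /mkfrac /num /den /=; ring.
Qed.

Lemma mulD : left_distributive mul add.
Proof.
elim/quotW=> x; elim/quotW=> y; elim/quotW=> z.
rewrite -!pi_add -!pi_mul -!pi_add.
by apply: eq_pi1; rewrite /addf /mulf /mkfrac /num /den /=; ring.
Qed.

Lemma one_neq0 : tofrac 1 != tofrac 0.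
Proof.
apply/eqP => /eqmodP/asboolP[u up]; rewrite /num /den /= mulr1 mul0r subr0 mulr1.
by move=> u0; move: up; rewrite u0 rpred0.
Qed.

HB.instance Definition _ :=
  GRing.Zmodule_isComNzRing.Build type mulA mulC mul1 mulD one_neq0.

Lemma tofrac_zmod_morphism : zmod_morphism tofrac.
Proof.
move=> a b; rewrite /tofrac -[RHS]/(add _ (opp _)) -pi_opp -pi_add.
by apply: eq_pi1; rewrite /addf /oppf /mkfrac /num /den /=; ring.
Qed.

Lemma tofrac_monoid_morphism : monoid_morphism tofrac.
Proof.
split=> [//|a b]; rewrite /tofrac -[RHS]/(mul _ _) -pi_mul.
by apply: eq_pi1; rewrite /mulf /mkfrac /num /den /=; ring.
Qed.

HB.instance Definition _ :=
  GRing.isZmodMorphism.Build R type tofrac tofrac_zmod_morphism.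
HB.instance Definition _ :=
  GRing.isMonoidMorphism.Build R type tofrac tofrac_monoid_morphism.

End Localization.
End Localization.
HB.export Localization.

Notation localization := Localization.type.
Notation toloc := Localization.tofrac.
Arguments Localization.type {R} p.
Arguments Localization.tofrac {R} p a.

(** R/I as an R-module. *)
Section QuotientModule.
Variables (R : comNzRingType) (I : idealr R).

Definition quot_scale (r : R) (x : {ideal_quot I}) : {ideal_quot I} :=
  \pi_{ideal_quot I} r * x.

Lemma quot_scaleA a b x : quot_scale a (quot_scale b x) = quot_scale (a * b) x.
Proof. by rewrite /quot_scale mulrA rmorphM. Qed.
Lemma quot_scale1 : left_id 1 quot_scale.
Proof. by move=> x; rewrite /quot_scale rmorph1 mul1r. Qed.
Lemma quot_scaleDr : right_distributive quot_scale +%R.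
Proof. by move=> a x y; rewrite /quot_scale mulrDr. Qed.
Lemma quot_scaleDl x : {morph quot_scale^~ x : a b / a + b}.
Proof. by move=> a b; rewrite /quot_scale rmorphD mulrDl. Qed.

HB.instance Definition _ := GRing.Zmodule_isLmodule.Build R {ideal_quot I}
  quot_scaleA quot_scale1 quot_scaleDr quot_scaleDl.
End QuotientModule.

Section Ideals.
Variable R : comNzRingType.

Definition ideal_gen (S : set R) : set R :=
  [set x | exists (n : nat) (c g : 'I_n -> R),
     (forall i, S (g i)) /\ x = \sum_(i < n) c i * g i].

Definition ideal_mul (A B : set R) : set R :=
  ideal_gen [set x | exists a b, [/\ A a, B b & x = a * b]].

Definition ideal_colon (A B : set R) : set R :=
  [set r | forall b, B b -> A (r * b)].

(* The unit ideal, which is not an [idealr], is always finitely generated. *)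
Definition noetherian : Prop :=
  forall J : idealr R, exists s : seq R, [set` J] = ideal_gen [set` s].

Definition regular_seq (s : seq R) : Prop :=
  (forall i, (i < size s)%N -> forall a,
     ideal_gen [set` take i s] (s`_i * a) -> ideal_gen [set` take i s] a)
  /\ ~ ideal_gen [set` s] 1.

Definition ideal_grade (I : idealr R) (n : nat) : Prop :=
  (exists s, [/\ regular_seq s, [set` s] `<=` [set` I] & size s = n])
  /\ (forall s, regular_seq s -> [set` s] `<=` [set` I] -> (size s <= n)%N).

(* There is a chain of primes p = c 0 > c 1 > ... > c n; the later values of c
   play no role. *)
Definition prime_height_ge (p : prime_idealr R) (n : nat) : Prop :=
  exists c : nat -> prime_idealr R, c 0%N = p /\
    forall i, (i < n)%N -> [set` c i.+1] `<` [set` c i].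

Definition prime_height (p : prime_idealr R) (n : nat) : Prop :=
  prime_height_ge p n /\ forall m, prime_height_ge p m -> (m <= n)%N.

Definition ideal_height (I : idealr R) (n : nat) : Prop :=
  (exists p : prime_idealr R, [set` I] `<=` [set` p] /\ prime_height p n)
  /\ (forall p : prime_idealr R, [set` I] `<=` [set` p] -> prime_height_ge p n).

Definition minimal_prime (I : idealr R) (p : prime_idealr R) : Prop :=
  [set` I] `<=` [set` p] /\
  forall q : prime_idealr R,
    [set` I] `<=` [set` q] -> [set` q] `<=` [set` p] -> [set` q] = [set` p].

End Ideals.

Section Modules.
Variable R : comNzRingType.

Definition injective_module (E : lmodType R) : Prop :=
  forall (M N : lmodType R) (f : {linear M -> N}) (g : {linear M -> E}),
    injective f -> exists h : {linear N -> E}, forall x, h (f x) = g x.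

Definition projective_module (P : lmodType R) : Prop :=
  forall (M N : lmodType R) (f : {linear M -> N}) (g : {linear P -> N}),
    (forall y, exists x, f x = y) ->
    exists h : {linear P -> M}, forall x, f (h x) = g x.

(** An injective resolution 0 -> M -> E 0 -> E 1 -> ... with E i = 0, i > n. *)
Definition injdim_le (M : lmodType R) (n : nat) : Prop :=
  exists (E : nat -> lmodType R) (eta : {linear M -> E 0%N})
         (d : forall i, {linear E i -> E i.+1}),
  [/\ (forall i, injective_module (E i)) /\
      (forall i, (n < i)%N -> forall x : E i, x = 0),
      injective eta,
      forall x, d 0%N x = 0 <-> exists m, eta m = x
    & forall i x, d i.+1 x = 0 <-> exists y, d i y = x].

(** A projective resolution ... -> P 1 -> P 0 -> M -> 0 with P i = 0, i > n. *)
Definition projdim_le (M : lmodType R) (n : nat) : Prop :=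
  exists (P : nat -> lmodType R) (eps : {linear P 0%N -> M})
         (d : forall i, {linear P i.+1 -> P i}),
  [/\ (forall i, projective_module (P i)) /\
      (forall i, (n < i)%N -> forall x : P i, x = 0),
      forall m, exists x, eps x = m,
      forall x, eps x = 0 <-> exists y, d 0%N y = x
    & forall i x, d i x = 0 <-> exists y, d i.+1 y = x].

Definition projdim (M : lmodType R) (n : nat) : Prop :=
  projdim_le M n /\ forall m, projdim_le M m -> (n <= m)%N.

End Modules.

Definition gorenstein (R : comNzRingType) : Prop :=
  noetherian R /\
  forall p : prime_idealr R, exists n,
    injdim_le ((localization p)^o : lmodType (localization p)) n.

Definition perfect_gorenstein_codim3 (R : comNzRingType) (I : idealr R) : Prop :=
  [/\ ideal_height I 3,
      ideal_grade I 3 /\ projdim ({ideal_quot I} : lmodType R) 3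
    & gorenstein {ideal_quot I}].

Definition localized_ideal (R : comNzRingType) (I : idealr R)
    (p : prime_idealr R) : set (localization p) :=
  ideal_gen (toloc p @` [set` I]).
Arguments localized_ideal {R} I p.

Definition generically_ci (R : comNzRingType) (I : idealr R) : Prop :=
  forall p : prime_idealr R, minimal_prime I p ->
  exists s : seq (localization p),
    regular_seq s /\ localized_ideal I p = ideal_gen [set` s].

(* Main.v *)
Require Import Defs.
From HB Require Import structures.
From mathcomp Require Import all_boot all_order all_algebra.
From mathcomp Require Import ring_quotient generic_quotient boolp classical_sets.
From mathcomp Require Import ring.

(** The colon condition says exactly that a socle element of [R/I] at a minimal
    prime does not annihilate [I/I^2].

    If [I] is generically a complete intersection and [x I] lies in [I^2] but
    [x] is not in [I], localize at an associated prime [q = I : xy].  The ring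
    [(R/I)_q] has depth zero and finite injective dimension, so it is
    self-injective and its maximal ideal is nilpotent; hence [q] is minimal over
    [I].  There [I_q] is generated by a regular sequence [s, b], and
    [x b] in [I_q^2], contained in [b I_q + (s)], forces [x] in [I_q], a
    contradiction.

    Conversely, localize at a minimal prime [p].  The quotient [A = (R/I)_p] is
    self-injective with a simple socle, and the socle acts nontrivially on
    [I/I^2], so (Vasconcelos) [I/I^2] has a free summand generated by some [x],
    which can be taken regular.  Then [A] is a retract of [I/xI], so it has
    projective dimension at most two over [R_p/x].  Comparing
    [Tor_2(A, R_p/(x, a, b))] computed from a resolution of [A] and from the Koszul
    complex, simplicity of the socle leaves a single second syzygy, so [I/x] has
    two generators (Hilbert--Burch). *)

Set Implicit Arguments.
Unset Strict Implicit.
Unset Printing Implicit Defensive.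

Import GRing.Theory.
Local Open Scope ring_scope.
Local Open Scope classical_set_scope.

(** * Ideals, matrices and Noetherian rings *)

(** The resolutions in the definitions consist of arbitrary modules and do not pass to localizations
    or quotients. Homological algebra is therefore done with matrices acting on row vectors: a
    finitely generated module is the cokernel of a matrix, a homomorphism out of it is a family of
    elements killed by the matrix, and projectivity of a syzygy module is recorded by a splitting
    matrix. Matrix identities map along every ring map. The Gorenstein hypothesis gives only a
    finite injective dimension; in depth zero, vanishing of one Ext on all cyclic modules forces
    vanishing of the previous one, and descending to Ext^1 gives self-injectivity. Perfection gives
    a resolution of I of length two with a projective last term; reduced modulo x it resolves I/xI
    over R_p/x, and this is the source of the bound two for the retract A. *)

Section Ideals.
Variable T : comNzRingType.

Definition invertible (a : T) : Prop := exists b, a * b = 1.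
(** Membership in the Jacobson radical, stated elementwise. In a local ring it cuts out the maximal
    ideal, so the residue field never has to be formed. *)
Definition jacobson (a : T) : Prop := forall c, invertible (1 - c * a).
Definition local_ring : Prop := forall a, invertible a \/ jacobson a.

Definition is_ideal (J : set T) : Prop :=
  J 0 /\ forall c a b, J a -> J b -> J (c * a + b).

Definition rowspan m n (A : 'M[T]_(m, n)) : set 'rV[T]_n :=
  [set v | exists w, v = w *m A].

Definition exact_mx c b a (A : 'M[T]_(c, b)) (B : 'M[T]_(b, a)) : Prop :=
  forall v : 'rV_b, v *m B = 0 <-> rowspan A v.

(* [f] generates [J]; ideals are identified with submodules of ['rV_1]. *)
Definition generates n (f : 'cV[T]_n) (J : set T) : Prop :=
  forall r, J r <-> rowspan f r%:M.

Definition fg_ideals : Prop :=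
  forall J, is_ideal J -> exists n (f : 'cV[T]_n), generates f J.

Definition is_submod n (K : set 'rV[T]_n) : Prop :=
  K 0 /\ forall c u v, K u -> K v -> K (c *: u + v).

Lemma ideal_add J a b : is_ideal J -> J a -> J b -> J (a + b).
Proof. by move=> [_ H] Ja Jb; rewrite -[a]mul1r; apply: H. Qed.

Lemma ideal_mull J c a : is_ideal J -> J a -> J (c * a).
Proof. by move=> [H0 H] Ja; rewrite -[c * a]addr0; apply: H. Qed.

Lemma ideal_mulr J c a : is_ideal J -> J a -> J (a * c).
Proof. by move=> HJ Ja; rewrite mulrC; apply: ideal_mull. Qed.

Lemma ideal_opp J a : is_ideal J -> J a -> J (- a).
Proof. by move=> HJ Ja; rewrite -mulN1r; apply: ideal_mull. Qed.

Lemma ideal_sub J a b : is_ideal J -> J a -> J b -> J (a - b).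
Proof. by move=> HJ Ja Jb; apply: ideal_add => //; apply: ideal_opp. Qed.

Lemma ideal_sum J (I : finType) (F : I -> T) :
  is_ideal J -> (forall i, J (F i)) -> J (\sum_i F i).
Proof.
move=> HJ HF; elim/big_ind: _ => //; first by case: HJ.
by move=> a b; apply: ideal_add.
Qed.

Lemma submodZ n (K : set 'rV[T]_n) c u : is_submod K -> K u -> K (c *: u).
Proof. by move=> [H0 H] Ku; rewrite -[c *: u]addr0; apply: H. Qed.

Lemma submodD n (K : set 'rV[T]_n) u v : is_submod K -> K u -> K v -> K (u + v).
Proof. by move=> [_ H] Ku Kv; rewrite -[u]scale1r; apply: H. Qed.

Lemma submodB n (K : set 'rV[T]_n) u v : is_submod K -> K u -> K v -> K (u - v).
Proof. by move=> HK Ku Kv; apply: submodD => //; rewrite -scaleN1r; apply: submodZ. Qed.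

Lemma submod_mulmx m n (K : set 'rV[T]_n) (A : 'M_(m, n)) (w : 'rV_m) :
  is_submod K -> (forall i, K (row i A)) -> K (w *m A).
Proof.
move=> HK HA; rewrite mulmx_sum_row; elim/big_ind: _ => //; first by case: HK.
- by move=> u v; apply: submodD.
- by move=> i _; apply: submodZ.
Qed.

Lemma rowspan_submod m n (A : 'M[T]_(m, n)) : is_submod (rowspan A).
Proof.
split; first by exists 0; rewrite mul0mx.
by move=> c u v [x ->] [y ->]; exists (c *: x + y); rewrite mulmxDl scalemxAl.
Qed.

Lemma rowspan_row m n (A : 'M[T]_(m, n)) i : rowspan A (row i A).
Proof. by exists (delta_mx 0 i); rewrite rowE. Qed.

Lemma rowspan_mulmx m n (A : 'M[T]_(m, n)) w : rowspan A (w *m A).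
Proof. by exists w. Qed.

Lemma rowspanP k m n (A : 'M[T]_(m, n)) (B : 'M_(k, n)) :
  (forall i, rowspan A (row i B)) -> exists C, B = C *m A.
Proof.
move=> /(_ _)/cid H; exists (\matrix_i sval (H i)).
by apply/row_matrixP => i; rewrite row_mul rowK; case: (H i).
Qed.

Lemma exact_mxP c b a k (A : 'M[T]_(c, b)) (B : 'M_(b, a)) (X : 'M_(k, b)) :
  exact_mx A B -> X *m B = 0 -> exists Y, X = Y *m A.
Proof.
by move=> H X0; apply: rowspanP => i; apply/H; rewrite -row_mul X0 row0.
Qed.

Lemma exact_mx0 c b a (A : 'M[T]_(c, b)) (B : 'M_(b, a)) :
  exact_mx A B -> A *m B = 0.
Proof.
by move=> H; apply/row_matrixP => i; rewrite row_mul row0; apply/H/rowspan_row.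
Qed.

Lemma generates_ideal n (f : 'cV[T]_n) J : generates f J -> is_ideal J.
Proof.
move=> Hf; have [h0 h] := rowspan_submod f.
split=> [|c a b]; first by apply/Hf; rewrite raddf0.
by move=> /Hf Ha /Hf Hb; apply/Hf; rewrite raddfD /= -scale_scalar_mx; apply: h.
Qed.

Lemma mx11E (A : 'M[T]_1) (r : T) : (A = r%:M) <-> A 0 0 = r.
Proof.
by split=> [->|<-]; [rewrite mxE eqxx | rewrite -mx11_scalar].
Qed.

Lemma generatesP n (f : 'cV[T]_n) J : generates f J ->
  forall r, J r <-> exists w : 'rV_n, r = \sum_i w 0 i * f i 0.
Proof.
move=> Hf r; rewrite Hf; split=> -[w e]; exists w; last first.
  by symmetry; apply/mx11E; rewrite mxE e.
by move/esym/mx11E: e => <-; rewrite mxE.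
Qed.

Lemma generates_mem n (f : 'cV[T]_n) J i : generates f J -> J (f i 0).
Proof.
move=> Hf; apply/Hf; exists (delta_mx 0 i); rewrite -rowE; symmetry.
by apply/mx11E; rewrite mxE.
Qed.

(** Induction on [n]: the first coordinates of [K] form an ideal, the vectors of [K] with first
    coordinate zero form a submodule in rank one less, and lifted generators of the former join
    generators of the latter. *)
Lemma fg_submod : fg_ideals -> forall n (K : set 'rV[T]_n), is_submod K ->
  exists c (N : 'M[T]_(c, n)), forall v, K v <-> rowspan N v.
Proof.
move=> noeT; elim=> [|n IHn] K HK.
  exists 0%N, 0 => v; split=> _.
    by exists 0; apply/rowP; case.
  by have -> : v = 0 by [apply/rowP; case]; case: HK.
rewrite -[n.+1]/(1 + n)%N in K HK *.
pose J : set T := [set r | exists v, K (row_mx r%:M v)].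
have [|m [f Hf]] := noeT J.
  split; first by exists 0; rewrite raddf0 row_mx0; case: HK.
  move=> c a b [u Ku] [v Kv]; exists (c *: u + v).
  by rewrite raddfD /= -scale_scalar_mx -add_row_mx -scale_row_mx; case: HK => _; apply.
have [|c [N HN]] := IHn [set v | K (row_mx 0 v)].
  split; first by rewrite /= row_mx0; case: HK.
  move=> c u v Ku Kv /=.
  have -> : row_mx 0 (c *: u + v) = c *: row_mx 0 u + row_mx (0 : 'M_1) v.
    by rewrite scale_row_mx add_row_mx scaler0 addr0.
  by case: HK => _; apply.
have /(_ _)/cid F (i : 'I_m) : J (f i 0) by apply: generates_mem.
exists (m + c)%N, (col_mx (row_mx f (\matrix_i sval (F i))) (row_mx 0 N)) => v.
have KN i : K (row i (col_mx (row_mx f (\matrix_i sval (F i))) (row_mx 0 N))).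
  case: (splitP i) => j ij.
    have -> : i = lshift c j by apply: val_inj.
    rewrite rowKu row_row_mx rowK; case: (F j) => /= w.
    by congr (K (row_mx _ _)); apply/esym/mx11E; rewrite mxE.
  have -> : i = rshift m j by apply: val_inj.
  rewrite rowKd row_row_mx row0.
  by have /HN := rowspan_row N j.
split=> [Kv|[w ->]]; last exact: submod_mulmx.
rewrite -[v]hsubmxK in Kv *.
have : J (lsubmx v 0 0).
  by exists (rsubmx v); rewrite -mx11_scalar.
move=> /Hf[w]; rewrite -mx11_scalar => ew.
pose u := \matrix_i sval (F i).
have Kw : K (row_mx (w *m f) (w *m u)).
  rewrite -mul_mx_row.
  apply: submod_mulmx => // i.
  by have := KN (lshift c i); rewrite rowKu.
have : K (row_mx 0 (rsubmx v - w *m u)).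
  by rewrite -(subrr (w *m f)) -{1}ew -add_row_mx -opp_row_mx; apply: submodB.
move=> /HN[w' ew']; exists (row_mx w w').
by rewrite mul_row_col !mul_mx_row mulmx0 add_row_mx addr0 -ew' -ew addrC subrK.
Qed.

Lemma ex_syzygies : fg_ideals -> forall b a (B : 'M[T]_(b, a)),
  exists c (A : 'M_(c, b)), exact_mx A B.
Proof.
move=> noeT b a B.
have [|c [N HN]] := fg_submod noeT (K := [set v : 'rV_b | v *m B = 0]).
  split=> [|c u v /= u0 v0] /=; first by rewrite mul0mx.
  by rewrite mulmxDl -scalemxAl u0 v0 scaler0 addr0.
by exists c, N.
Qed.

Definition seq_ideal (y : nat -> T) k : set T :=
  [set r | exists c : 'I_k -> T, r = \sum_i c i * y i].

(** The ascending chain condition without chains: the union of the ideals [seq_ideal y k] has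
    finitely many generators, all lying in one [seq_ideal y K], and [y K] itself lies in the
    union. *)
Lemma noeth_seq : fg_ideals -> forall (y : nat -> T),
  exists k, seq_ideal y k (y k).
Proof.
move=> noeT y.
pose J : set T := [set r | exists k, seq_ideal y k r].
have mono k l r : (k <= l)%N -> seq_ideal y k r -> seq_ideal y l r.
  move=> kl [c ->].
  exists (fun i => if insub (val i) is Some j then c j else 0).
  have := big_ord_widen_cond l xpredT (fun i => (if insub i is Some j then c j else 0) * y i) kl.
  rewrite /= => E; have -> : \sum_(i < k) c i * y i =
      \sum_(i < k) (if insub (val i) is Some j then c j else 0) * y i.
    by apply: eq_bigr => i _; rewrite valK.
  rewrite E [LHS]big_mkcond /=; apply: eq_bigr => i _.
  by case: ifP => // ik; rewrite insubN ?ik // mul0r.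
have [|n [f Hf]] := noeT J.
  split; first by exists 0%N, (fun=> 0); rewrite big_ord0.
  move=> c a b [k Ha] [l Hb]; exists (maxn k l).
  have [u ->] := mono _ _ _ (leq_maxl k l) Ha.
  have [v ->] := mono _ _ _ (leq_maxr k l) Hb.
  exists (fun i => c * u i + v i).
  rewrite mulr_sumr -big_split; apply: eq_bigr => i _ /=; ring.
have /(_ _)/cid F (i : 'I_n) : J (f i 0) by apply: generates_mem.
pose K := \max_i sval (F i).
exists K.
have : J (y K).
  exists K.+1, (fun i => (i == ord_max)%:R); rewrite (bigD1 ord_max) //= eqxx mul1r.
  by rewrite big1 ?addr0 // => i /negPf ->; rewrite mul0r.
move=> /(generatesP Hf)[w ->].
have : forall i, seq_ideal y K (f i 0).
  by move=> i; apply: mono (proj2_sig (F i)); apply: leq_bigmax.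
move=> /(_ _)/cid G; exists (fun j => \sum_i w 0 i * sval (G i) j).
under [RHS]eq_bigr do rewrite mulr_suml.
rewrite exchange_big; apply: eq_bigr => i _ /=.
case: (G i) => c /= ->; rewrite mulr_sumr; apply: eq_bigr => j _; ring.
Qed.

Lemma noeth_max : fg_ideals -> forall (X : set (set T)) J0,
  (forall J, X J -> is_ideal J) -> X J0 ->
  exists J, X J /\ forall J', X J' -> J `<=` J' -> J' = J.
Proof.
move=> noeT X J0 XI XJ0; apply: contrapT => /forallNP nomax.
have next (J : {J | X J}) : {K : {J | X J} * T | sval J `<=` sval K.1 /\
     sval K.1 K.2 /\ ~ sval J K.2}.
  apply: cid; case: J => J XJ /=.
  have := nomax J => /not_andP[//|/existsNP[J' /not_implyP[XJ' /not_implyP[sub neq]]]].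
  have [r Jr nJr] : exists2 r, J' r & ~ J r.
    apply: contrapT => H; apply: neq; apply/seteqP; split=> // r J'r.
    by apply: contrapT => nJ; apply: H; exists r.
  by exists (exist _ J' XJ', r).
(* Dependent choice: if nothing is maximal, each ideal of the chain extends strictly, as [y n]
   witnesses. By [noeth_seq] some [y k] is a combination of its predecessors, which all lie in
   [chain k]. *)
pose chain := fix chain n := if n is m.+1 then (sval (next (chain m))).1
                             else exist _ J0 XJ0.
pose y n := (sval (next (chain n))).2.
have step n : sval (chain n) `<=` sval (chain n.+1) /\
    sval (chain n.+1) (y n) /\ ~ sval (chain n) (y n).
  by rewrite /y /=; case: (next _).
have mono n m : (n <= m)%N -> sval (chain n) `<=` sval (chain m).
  move=> /subnK <-; elim: (m - n)%N => // k IH.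
  by rewrite addSn; apply: subset_trans IH _; case: (step (k + n)%N).
have [k [c ek]] := noeth_seq noeT y.
case: (step k) => _ [_]; apply; rewrite ek.
have HI := XI _ (proj2_sig (chain k)).
apply: ideal_sum => // i; apply: ideal_mull => //.
by apply: (mono i.+1); rewrite ?ltn_ord //; case: (step i) => _ [].
Qed.

Definition is_prime (q : set T) : Prop :=
  [/\ is_ideal q, ~ q 1 & forall a b, q (a * b) -> q a \/ q b].

Definition colon1 (J : set T) y : set T := [set r | J (r * y)].

Lemma colon1_ideal J y : is_ideal J -> is_ideal (colon1 J y).
Proof.
move=> HJ; split; first by rewrite /colon1 /= mul0r; case: HJ.
by move=> c a b Ja Jb; rewrite /colon1 /= mulrDl -mulrA; case: HJ => _; apply.
Qed.

(** A maximal member among the colon ideals of the multiples of [x] outside [J] is prime. Keeping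
    the factor [x] makes the prime contain [J : x], so [x] remains outside [J] after localizing
    there. *)
Lemma ex_assoc_prime : fg_ideals -> forall J x, is_ideal J -> ~ J x ->
  exists y, ~ J (y * x) /\ is_prime (colon1 J (y * x)).
Proof.
move=> noeT J x HJ nJx.
pose X := [set q | exists y, ~ J (y * x) /\ q = colon1 J (y * x)].
have [||q [[y [nJ ->]] qmax]] := @noeth_max noeT X (colon1 J x).
- by move=> _ [y [_ ->]]; apply: colon1_ideal.
- by exists 1; rewrite mul1r.
exists y; split=> //; split; first exact: colon1_ideal.
  by rewrite /colon1 /= mul1r.
move=> a b; rewrite /colon1 /= => Jab.
have [|nJb] := pselect (J (b * (y * x))); first by right.
left; have E : colon1 J (b * y * x) = colon1 J (y * x); last first.
  rewrite -[J _]/(colon1 J (y * x) a) -E /colon1 /=.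
  by have -> : a * (b * y * x) = a * b * (y * x) by ring.
  apply: qmax; first by exists (b * y); rewrite -mulrA.
move=> r; rewrite /colon1 /= => Jr.
by have -> : r * (b * y * x) = b * (r * (y * x)) by [ring]; apply: ideal_mull.
Qed.

Lemma invertibleM a b : invertible a -> invertible b -> invertible (a * b).
Proof. by move=> [c ac] [d bd]; exists (c * d); rewrite mulrACA ac bd mulr1. Qed.

Lemma jacobsonM c a : jacobson a -> jacobson (c * a).
Proof. by move=> H d; rewrite mulrA; apply: H. Qed.

Lemma jacobson_ideal : is_ideal jacobson.
Proof.
split; first by move=> c; exists 1; rewrite mulr0 subr0 mulr1.
move=> c a b Ja Jb d.
have [e He] := Ja (d * c).
have [g Hg] := Jb (e * d).
exists (e * g).
transitivity ((1 - d * c * a) * e * g - e * d * b * g); first by ring.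
by rewrite He -mulrBl.
Qed.

Lemma jacobson_ninv a : jacobson a -> ~ invertible a.
Proof.
move=> /(_ _) H [b ab]; have [c] := H b.
by rewrite mulrC [b * a]mulrC ab subrr mulr0 => /esym/eqP; rewrite oner_eq0.
Qed.

Lemma local_jacobson a : local_ring -> ~ invertible a -> jacobson a.
Proof. by move=> /(_ a)[]. Qed.

(** Modulo the radical [1%:M - M] is the identity, so its determinant is 1; once the determinant is
    a unit, the adjugate inverts the matrix. *)
Lemma det1B n (M : 'M[T]_n) : (forall i j, jacobson (M i j)) -> jacobson (1 - \det (1%:M - M)).
Proof.
move=> HM; have HJ := jacobson_ideal.
elim: n M HM => [|n IHn] M HM; first by rewrite det_mx00 subrr; case: HJ.
rewrite (expand_det_row _ ord0) big_ord_recl.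
rewrite opprD addrA; apply: (ideal_sub HJ); last first.
  apply: (ideal_sum HJ) => i; apply: (ideal_mulr _ HJ); rewrite !mxE /= sub0r.
  exact: (ideal_opp HJ).
rewrite !mxE eqxx /= /cofactor expr0 mul1r mulrBl mul1r opprB addrC -addrA.
apply: (ideal_add HJ); first exact: (ideal_mulr _ HJ).
rewrite addrC; set N := row' _ _.
have -> : N = 1%:M - row' ord0 (col' ord0 M).
  by apply/matrixP => i j; rewrite !mxE (inj_eq lift_inj).
by apply: IHn => i j; rewrite !mxE.
Qed.

Lemma jacobson_inv1B a : jacobson (1 - a) -> invertible a.
Proof. by move=> /(_ 1); rewrite mul1r opprB addrC subrK. Qed.

Lemma mx_inv1B n (M : 'M[T]_n) : (forall i j, jacobson (M i j)) ->
  exists N, N *m (1%:M - M) = 1%:M.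
Proof.
move=> /det1B/jacobson_inv1B[b Hb]; exists (b *: \adj (1%:M - M)).
by rewrite -scalemxAl mul_adj_mx -mul_scalar_mx -scalar_mxM mulrC Hb.
Qed.

Lemma mx_inv1Br n (M : 'M[T]_n) : (forall i j, jacobson (M i j)) ->
  exists N, (1%:M - M) *m N = 1%:M.
Proof.
move=> /det1B/jacobson_inv1B[b Hb]; exists (b *: \adj (1%:M - M)).
by rewrite -scalemxAr mul_mx_adj -mul_scalar_mx -scalar_mxM mulrC Hb.
Qed.

(** On generators the hypothesis reads [f = M *m f + k] with [M] in the radical, and inverting
    [1%:M - M] expresses [f] through the entries of [k], which lie in [K]. *)
Lemma nakayama (J K : set T) : fg_ideals -> is_ideal J -> is_ideal K ->
  (forall r, J r -> exists a t k, [/\ jacobson a, J t, K k & r = a * t + k]) ->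
  J `<=` K.
Proof.
move=> noeT HJ HK H.
have [n [f Hf]] := noeT J HJ.
have {}H (i : 'I_n) : exists w : 'rV_n * T, [/\ K w.2, (forall j, jacobson (w.1 0 j)) &
   f i 0 = (w.1 *m f) 0 0 + w.2].
  have [a [t [k [ja Jt Kk e]]]] := H _ (generates_mem i Hf).
  have /Hf[w ew] := Jt; exists (a *: w, k); split=> // [j|].
    by rewrite mxE; rewrite mulrC; apply: jacobsonM.
  by rewrite e -scalemxAl mxE /=; move/esym/mx11E : ew => ->.
move: H => /(_ _)/cid F.
pose M := \matrix_i (sval (F i)).1.
pose k := \col_i (sval (F i)).2.
have eM : (1%:M - M) *m f = k.
  apply/colP => i; rewrite mulmxBl mul1mx mxE [(- _ : 'cV_n) i 0]mxE [k i 0]mxE.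
  have [_ _ {1}->] := proj2_sig (F i).
  have -> : (M *m f) i 0 = ((sval (F i)).1 *m f) 0 0.
    by rewrite !mxE; apply: eq_bigr => j _; rewrite mxE.
  by rewrite addrC addKr.
have [|N NM] := @mx_inv1B _ M.
  by move=> i j; rewrite mxE; have [_] := proj2_sig (F i).
move=> r /Hf[w]; rewrite -[f]mul1mx -NM -mulmxA eM mulmxA => /esym/mx11E <-.
rewrite mxE; apply: ideal_sum => // i; apply: ideal_mull => //; rewrite mxE.
by have [] := proj2_sig (F i).
Qed.

End Ideals.

(** * Lifting properties of injective and projective modules *)

Section RowImage.
Variables (T : comNzRingType) (b a : nat) (D : 'M[T]_(b, a)).

Definition rowimg_pred : {pred 'rV[T]_a} := fun v => `[< rowspan D v >].

Fact rowimg_submod_closed : submod_closed rowimg_pred.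
Proof.
have [h0 h] := rowspan_submod D.
split; first by apply/asboolP.
by move=> c u v /asboolP Hu /asboolP Hv; apply/asboolP; apply: h.
Qed.

HB.instance Definition _ :=
  GRing.isSubmodClosed.Build T 'rV[T]_a rowimg_pred rowimg_submod_closed.

(** Injectivity and projectivity quantify over module types, so the row span has to become one. *)
Record rowimg := RowImg { rowimg_val :> 'rV[T]_a; _ : rowimg_val \in rowimg_pred }.
HB.instance Definition _ := [isSub for rowimg_val].
HB.instance Definition _ := [Choice of rowimg by <:].
HB.instance Definition _ := [SubChoice_isSubLmodule of rowimg by <:].

Lemma rowimgP (w : rowimg) : exists v, val w = v *m D.
Proof. by case: w => w /= /asboolP. Qed.

Definition to_rowimg (v : 'rV[T]_b) : rowimg :=
  RowImg (asboolT (rowspan_mulmx D v) : _ \in rowimg_pred).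

End RowImage.

Section Pairing.
Variables (T : comNzRingType) (E : lmodType T).

(** A family [y] is a homomorphism from T^a to [E] given on the basis; [mxact D y] is its composite
    with [D]. *)
Definition mxact b a (D : 'M[T]_(b, a)) (y : 'I_a -> E) (j : 'I_b) : E :=
  \sum_l D j l *: y l.

Lemma mxactM c b a (C : 'M[T]_(c, b)) (D : 'M_(b, a)) y j :
  mxact (C *m D) y j = mxact C (mxact D y) j.
Proof.
rewrite /mxact; under [RHS]eq_bigr do rewrite scaler_sumr.
rewrite exchange_big; apply: eq_bigr => l _ /=.
by rewrite mxE scaler_suml; apply: eq_bigr => k _; rewrite scalerA.
Qed.

Lemma mxactD b a (C D : 'M[T]_(b, a)) y j :
  mxact (C + D) y j = mxact C y j + mxact D y j.
Proof.
by rewrite /mxact -big_split; apply: eq_bigr => l _; rewrite mxE scalerDl.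
Qed.

Lemma mxactZ b a c (D : 'M[T]_(b, a)) y j :
  mxact (c *: D) y j = c *: mxact D y j.
Proof.
by rewrite /mxact scaler_sumr; apply: eq_bigr => l _; rewrite mxE scalerA.
Qed.

Lemma mxactN b a (D : 'M[T]_(b, a)) y j : mxact (- D) y j = - mxact D y j.
Proof. by rewrite -[- D]scaleN1r mxactZ scaleN1r. Qed.

Lemma mxact0 b a (y : 'I_a -> E) j : mxact (0 : 'M[T]_(b, a)) y j = 0.
Proof. by rewrite /mxact big1 // => l _; rewrite mxE scale0r. Qed.

Lemma mxact1 a (y : 'I_a -> E) j : mxact (1%:M : 'M[T]_a) y j = y j.
Proof.
rewrite /mxact (bigD1 j) //= mxE eqxx scale1r big1 ?addr0 // => l lj.
by rewrite mxE eq_sym (negPf lj) scale0r.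
Qed.

Lemma mxactDr b a (D : 'M[T]_(b, a)) y z j :
  mxact D (fun l => y l + z l) j = mxact D y j + mxact D z j.
Proof.
by rewrite /mxact -big_split; apply: eq_bigr => l _; rewrite scalerDr.
Qed.

Lemma mxactNr b a (D : 'M[T]_(b, a)) y j :
  mxact D (fun l => - y l) j = - mxact D y j.
Proof. by rewrite /mxact -sumrN; apply: eq_bigr => l _; rewrite scalerN. Qed.

Lemma mxactBr b a (D : 'M[T]_(b, a)) y z j :
  mxact D (fun l => y l - z l) j = mxact D y j - mxact D z j.
Proof. by rewrite mxactDr mxactNr. Qed.

Lemma mxact0r b a (D : 'M[T]_(b, a)) (y : 'I_a -> E) j :
  (forall l, y l = 0) -> mxact D y j = 0.
Proof. by move=> y0; rewrite /mxact big1 // => l _; rewrite y0 scaler0. Qed.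

Lemma eq_mxact b a (D : 'M[T]_(b, a)) (y z : 'I_a -> E) j :
  y =1 z -> mxact D y j = mxact D z j.
Proof. by move=> yz; apply: eq_bigr => l _; rewrite yz. Qed.

Lemma mxact_row b a (D : 'M[T]_(b, a)) (y : 'I_a -> E) j :
  mxact D y j = mxact (row j D) y 0.
Proof. by apply: eq_bigr => l _; rewrite mxE. Qed.

Lemma mxact_linear b a (D : 'M[T]_(b, a)) (F : lmodType T) (h : {linear F -> E})
  (y : 'I_a -> F) j : mxact D (fun l => h (y l)) j = h (\sum_l D j l *: y l).
Proof. by rewrite linear_sum; apply: eq_bigr => l _; rewrite linearZ. Qed.

(* Systems of linear equations over an injective module are solvable as soon
   as they satisfy the obvious compatibility condition. *)
Lemma injective_solve (injE : injective_module E) b a (D : 'M[T]_(b, a)) z :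
  (forall v : 'rV_b, v *m D = 0 -> mxact v z 0 = 0) ->
  exists y, forall j, z j = mxact D y j.
Proof.
move=> compat.
(* [g0] sends [v *m D] to the pairing of [v] with [z]; [compat] makes this independent of [v]. An
   extension to all row vectors, evaluated on the basis, is the solution. *)
pose g0 (w : rowimg D) : E := mxact (sval (cid (rowimgP w))) z 0.
have g0E (w : rowimg D) v : val w = v *m D -> g0 w = mxact v z 0.
  rewrite /g0; case: (cid _) => u /= -> /eqP.
  rewrite -subr_eq0 -mulmxBl => /eqP/compat; rewrite mxactD mxactN => /eqP.
  by rewrite subr_eq0 => /eqP.
have g0lin : linear g0.
  move=> c u v; have [x ex] := rowimgP u; have [y ey] := rowimgP v.
  rewrite (g0E _ _ ex) (g0E _ _ ey) -mxactZ -mxactD; apply: g0E.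
  by rewrite linearP /= ex ey mulmxDl scalemxAl.
pose gl := GRing.isLinear.Build T (rowimg D) E _ g0 g0lin.
pose g : {linear rowimg D -> E} := HB.pack g0 gl.
have [|h hg] := @injE _ _ (val : {linear rowimg D -> 'rV[T]_a}) g.
  exact: val_inj.
exists (fun l => h (delta_mx 0 l)) => j.
transitivity (g (to_rowimg D (delta_mx 0 j))).
  rewrite [RHS](g0E (to_rowimg D (delta_mx 0 j)) (delta_mx 0 j) erefl).
  by rewrite -[LHS]mxact1 mxact_row rowE mulmx1.
rewrite -hg /= -rowE mxact_linear; congr (h _).
apply/rowP=> l; rewrite mxE summxE (bigD1 l) //= big1 ?addr0 => [|k kl].
  by rewrite !mxE !eqxx mulr1.
by rewrite !mxE eq_sym (negPf kl) andbF mulr0.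
Qed.

End Pairing.

Lemma linear_mxact (T : comNzRingType) (E F : lmodType T) b a (D : 'M[T]_(b, a))
  (h : {linear F -> E})
  (y : 'I_a -> F) j : h (mxact D y j) = mxact D (fun l => h (y l)) j.
Proof. by rewrite mxact_linear. Qed.

Section ProjectiveLift.
Variable T : comNzRingType.

Lemma projective_lift (P : lmodType T) : projective_module P ->
  forall b a (D : 'M[T]_(b, a)) (g : {linear P -> 'rV[T]_a}),
  (forall x, rowspan D (g x)) ->
  exists h : {linear P -> 'rV[T]_b}, forall x, h x *m D = g x.
Proof.
move=> projP b a D g Hg.
pose g0 (x : P) : rowimg D := RowImg (asboolT (Hg x) : _ \in rowimg_pred D).
have g0lin : linear g0 by move=> c u v; apply: val_inj; rewrite /= !linearP.
pose gl := GRing.isLinear.Build T P (rowimg D) _ g0 g0lin.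
pose g1 : {linear P -> rowimg D} := HB.pack g0 gl.
have tlin : linear (to_rowimg D).
  by move=> c u v; apply: val_inj; rewrite /= mulmxDl scalemxAl.
pose tl := GRing.isLinear.Build T _ _ _ (to_rowimg D) tlin.
pose t : {linear 'rV[T]_b -> rowimg D} := HB.pack (to_rowimg D) tl.
have [|h hg] := projP _ _ t g1.
  by move=> y; have [v ev] := rowimgP y; exists v; apply: val_inj.
by exists h => x; have /(congr1 val) := hg x.
Qed.

End ProjectiveLift.

(** * Finite injective dimension in depth zero *)

Section InjectiveResolution.
Variables (T : comNzRingType) (noeT : fg_ideals T).
Variables (E : nat -> lmodType T) (eta : {linear T^o -> E 0%N}).
Variable d : forall i, {linear E i -> E i.+1}.
Arguments d : clear implicits.
Hypothesis injE : forall i, injective_module (E i).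
Hypothesis eta_inj : injective eta.
Hypothesis exact0 : forall x, d 0%N x = 0 <-> exists m, eta m = x.
Hypothesis exactS : forall i x, d i.+1 x = 0 <-> exists y, d i y = x.

(** Such an [e] is the image of 1 under a homomorphism from T/J to [E i]. *)
Definition killed i (J : set T) (e : E i) : Prop := forall j, J j -> j *: e = 0.

(* [Ext^(i+1)(T/J, T) = 0] *)
Definition ext_vanish i (J : set T) : Prop :=
  forall e : E i.+1, killed J e -> d i.+1 e = 0 ->
  exists e' : E i, killed J e' /\ d i e' = e.

Lemma dd0 i x : d i.+1 (d i x) = 0.
Proof. by apply/exactS; exists x. Qed.

Lemma killedB i J (e f : E i) : killed J e -> killed J f -> killed J (e - f).
Proof. by move=> He Hf j Jj; rewrite scalerBr He // Hf // subrr. Qed.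

Lemma killedD i J (e f : E i) : killed J e -> killed J f -> killed J (e + f).
Proof. by move=> He Hf j Jj; rewrite scalerDr He // Hf // addr0. Qed.

Lemma killed_d i J (e : E i) : killed J e -> killed J (d i e).
Proof. by move=> He j Jj; rewrite -linearZ He // linear0. Qed.

Lemma killed_sub i (J K : set T) (e : E i) : K `<=` J -> killed J e -> killed K e.
Proof. by move=> KJ He j /KJ; apply: He. Qed.

(* A homomorphism defined on [y(T/J) = T/(J : y)] extends to [T/J]. *)
Lemma killed_extend i J y (e : E i) : is_ideal J -> killed (colon1 J y) e ->
  exists e', killed J e' /\ y *: e' = e.
Proof.
move=> HJ He; have [n [f Hf]] := noeT HJ.
pose z (k : 'I_(n + 1)) : E i := if split k is inr _ then e else 0.
have zl k : z (lshift 1 k) = 0.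
  by rewrite /z; case: splitP => // k' /= ek; have := ltn_ord k; rewrite ek ltnNge leq_addr.
have zr k : z (rshift n k) = e.
  by rewrite /z; case: splitP => // k' /= ek; have := ltn_ord k'; rewrite -ek ltnNge leq_addr.
have [|g Hg] := @injective_solve _ _ (@injE i) _ _ (col_mx f y%:M) z.
  move=> v; rewrite -[v]hsubmxK mul_row_col mul_mx_scalar => /eqP.
  rewrite addr_eq0 => /eqP e0.
  rewrite /mxact big_split_ord /= big1 ?add0r => [|k _]; last by rewrite zl scaler0.
  rewrite big_ord1 zr row_mxEr; apply: He; apply/Hf.
  exists (- lsubmx v); rewrite mulNmx e0 opprK; symmetry; apply/mx11E.
  by rewrite mxE mulrC.
exists (g 0); split=> [j /(generatesP Hf)[w ->]|].
  rewrite scaler_suml big1 // => k _; have := Hg (lshift 1 k).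
  by rewrite zl /mxact big_ord1 col_mxEu -scalerA => <-; rewrite scaler0.
by have := Hg (rshift n 0); rewrite zr /mxact big_ord1 col_mxEd mxE => ->.
Qed.

Definition adjoin (J : set T) y : set T := [set r | exists j c, J j /\ r = j + c * y].

Lemma adjoin_ideal J y : is_ideal J -> is_ideal (adjoin J y).
Proof.
move=> HJ; split; first by exists 0, 0; split; [case: HJ | ring].
move=> c _ _ [j [r [Jj ->]]] [k [s [Jk ->]]].
by exists (c * j + k), (c * r + s); split; [case: HJ => _; apply | ring].
Qed.

Lemma adjoin_sub (J : set T) y : J `<=` adjoin J y.
Proof. by move=> j Jj; exists j, 0; rewrite mul0r addr0. Qed.

Lemma adjoin_mem (J : set T) y : is_ideal J -> adjoin J y y.
Proof. by case=> J0 _; exists 0, 1; rewrite mul1r add0r. Qed.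

Lemma killed_adjoin i J y (e : E i) : killed J e -> y *: e = 0 -> killed (adjoin J y) e.
Proof.
by move=> He ye _ [j [c [Jj ->]]]; rewrite scalerDl He // -scalerA ye scaler0 addr0.
Qed.

(** The long exact sequence of 0 -> T/(J : y) -> T/J -> T/(J, y) -> 0, whose first map is
    multiplication by [y], at its middle term. *)
Lemma ext_vanish_short i J y : is_ideal J ->
  ext_vanish i (colon1 J y) -> ext_vanish i (adjoin J y) -> ext_vanish i J.
Proof.
move=> HJ Hc Ha e He de.
have [||e1 [He1 de1]] := Hc (y *: e); last 1 first.
- have [e2 [He2 ye2]] := killed_extend HJ He1.
  have [||e3 [He3 de3]] := Ha (e - d i e2).
  + apply: killed_adjoin; first by apply: killedB => //; apply: killed_d.
    by rewrite scalerBr -linearZ ye2 de1 subrr.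
  + by rewrite linearB de dd0 subrr.
  exists (e2 + e3); split; last by rewrite linearD de3 addrC subrK.
  by apply: killedD => //; apply: killed_sub He3; apply: adjoin_sub.
- by move=> r; rewrite /colon1 /= => Jr; rewrite scalerA He.
- by rewrite linearZ /= de scaler0.
Qed.

(** In the same sequence for J = 0 the middle Ext vanishes, so the group for T/(0 : s) embeds in the
    group for T/(s) one degree higher. For a nonzero socle element [s] of a local ring, T/(0 : s) is
    the residue field. *)
Lemma ext_vanish_socle i s : (forall J, is_ideal J -> ext_vanish i.+1 J) ->
  ext_vanish i (colon1 [set 0] s).
Proof.
move=> H e He de.
have I0 : is_ideal [set (0 : T)].
  by split=> // c a b /= -> ->; rewrite mulr0 addr0.
have [e1 [_ se1]] := killed_extend I0 He.
have [|||e2 [He2 de2]] := H (adjoin [set 0] s) _ (d i.+1 e1).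
- exact: adjoin_ideal.
- apply: killed_adjoin; first by move=> j /= ->; rewrite scale0r.
  by rewrite -linearZ se1.
- exact: dd0.
have /exactS[t et] : d i.+1 (e1 - e2) = 0 by rewrite linearB de2 subrr.
exists (s *: t); split; first by move=> r /= rs; rewrite scalerA rs scale0r.
rewrite linearZ /= et scalerBr se1 He2 ?subr0 //; exact: adjoin_mem.
Qed.

(** The sequence 0 -> T/q -> T/q -> T/(q, x) -> 0 given by multiplication by [x]: vanishing for
    T/(q, x) one degree up makes [x] act surjectively on Ext^(i+1)(T/q, T). *)
Lemma ext_divisible i q x : is_ideal q -> colon1 q x `<=` q ->
  ext_vanish i.+1 (adjoin q x) ->
  forall e : E i.+1, killed q e -> d i.+1 e = 0 ->
  exists e1, [/\ killed q e1, d i.+1 e1 = 0 & x *: e1 = e].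
Proof.
move=> Hq qx H e He de.
have [e1 [He1 xe1]] := killed_extend Hq (killed_sub qx He).
have [||e2 [He2 de2]] := H (d i.+1 e1).
- by apply: killed_adjoin; [apply: killed_d | rewrite -linearZ xe1].
- exact: dd0.
exists (e1 - e2); split; last by rewrite scalerBr xe1 He2 ?subr0 //; apply: adjoin_mem.
- by apply: killedB => //; apply: killed_sub He2; apply: adjoin_sub.
- by rewrite linearB de2 subrr.
Qed.

(** A family killed by [D] is a homomorphism from coker D to [E i]; cocycles modulo coboundaries are
    Ext^i(coker D, T). *)
Definition cocycle i b a (D : 'M[T]_(b, a)) (e : 'I_a -> E i) : Prop :=
  (forall j, mxact D e j = 0) /\ forall l, d i (e l) = 0.

Definition coboundary i b a (D : 'M[T]_(b, a)) : ('I_a -> E i) -> Prop :=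
  match i with
  | 0%N => fun e => forall l, e l = 0
  | i'.+1 => fun e => exists u : 'I_a -> E i',
      (forall j, mxact D u j = 0) /\ forall l, e l = d i' (u l)
  end.

Lemma solve_syzygies i c b a (C : 'M[T]_(c, b)) (D : 'M_(b, a)) (z : 'I_b -> E i) :
  exact_mx C D -> (forall j, mxact C z j = 0) -> exists y, forall j, z j = mxact D y j.
Proof.
move=> ex Cz; apply: injective_solve (@injE i) _ _ _ _ _ => v /ex[w ->].
by rewrite mxactM; apply: mxact0r.
Qed.

Lemma coboundary_solve i c b a (C : 'M[T]_(c, b)) (D : 'M_(b, a)) (t : 'I_b -> E i) :
  exact_mx C D -> coboundary C t ->
  exists w, (forall j, t j = mxact D w j) /\ forall l, d i (w l) = 0.
Proof.
move=> ex; case: i t => [|i] t /=.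
  move=> t0; exists (fun=> 0); split=> [j|l]; last by rewrite linear0.
  by rewrite t0 mxact0r.
move=> [u [Cu tu]]; have [w Hw] := solve_syzygies ex Cu.
exists (fun l => d i (w l)); split=> [j|l]; last exact: dd0.
by rewrite tu Hw mxact_linear.
Qed.

(* Finite generation of [Ext^i(coker D, T)], by dimension shifting in the first
   variable. *)
Lemma ext_fg i b a (D : 'M[T]_(b, a)) : exists r (z : 'I_r -> 'I_a -> E i),
  (forall k, cocycle D (z k)) /\
  forall e, cocycle D e -> exists (c : 'I_r -> T) t, coboundary D t /\
    forall l, e l = \sum_k c k *: z k l + t l.
Proof.
elim: i b a D => [|i IHi] b a D.
  have [r [N HN]] := ex_syzygies noeT D^T.
  exists r, (fun k l => eta (N k l)); split.
    move=> k; split=> [j|l]; last by apply/exact0; exists (N k l).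
    rewrite (mxact_linear D eta (fun l => N k l : T^o)).
    have /matrixP/(_ k j) := exact_mx0 HN.
    rewrite mxE [RHS]mxE => e0; rewrite -[RHS](linear0 eta); congr (eta _); rewrite -[RHS]e0.
    by apply: eq_bigr => l _; rewrite mxE mulrC.
  move=> e [De /(_ _)/exact0/cid de].
  pose w : 'rV_a := \row_l sval (de l).
  have ew l : e l = eta (w 0 l) by rewrite mxE; case: (de l).
  have /HN[u eu] : w *m D^T = 0.
    apply/rowP => j; rewrite mxE [RHS]mxE; apply: eta_inj; rewrite linear0 -[RHS](De j).
    rewrite (eq_mxact _ _ ew) (mxact_linear D eta (fun l => w 0 l : T^o)).
    by apply: (congr1 eta); apply: eq_bigr => l _; rewrite [D^T _ _]mxE mulrC.
  exists (fun k => u 0 k), (fun=> 0); split=> // l.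
  rewrite addr0 ew eu mxE (linear_sum eta); apply: eq_bigr => k _.
  by rewrite -[_ * _]/(u 0 k *: (N k l : T^o)) linearZ.
have [c [C exC]] := ex_syzygies noeT D.
have [r [z [Hz gen]]] := IHi c b C.
(* [C] presents the row span of [D]. A cocycle [z k] on it is written as [D] applied to some [y],
   and applying [d i] to [y] is the connecting map into the next Ext of coker D, which is onto. *)
have /(_ _)/cid F k : exists y, forall j, z k j = mxact D y j.
  by apply: solve_syzygies exC _; case: (Hz k).
pose y k := sval (F k).
have zy k j : z k j = mxact D (y k) j by rewrite /y; case: (F k).
exists r, (fun k l => d i (y k l)); split.
  move=> k; split=> [j|l]; last exact: dd0.
  by rewrite mxact_linear -/(mxact D (y k) j) -zy; case: (Hz k).
move=> e [De /(_ _)/exactS/cid de].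
pose t l := sval (de l).
have et l : e l = d i (t l) by rewrite /t; case: (de l).
have [|a' [t' [/(coboundary_solve exC)[w [tw dw]] Dt]]] := gen (mxact D t).
  split=> [j|j]; first by rewrite -mxactM (exact_mx0 exC) mxact0.
  by rewrite -(mxact_linear D (d i)) -[RHS](De j); apply: eq_mxact => l; rewrite et.
exists a', (fun l => d i (t l - w l - \sum_k a' k *: y k l)); split; last first.
  move=> l; rewrite et !linearB dw subr0 linear_sum /=.
  by under [X in _ - X]eq_bigr do rewrite linearZ /=; rewrite addrC subrK.
exists (fun l => t l - w l - \sum_k a' k *: y k l); split=> // j.
rewrite !mxactBr Dt tw addrK; apply/eqP; rewrite subr_eq0; apply/eqP.
rewrite /mxact; under [RHS]eq_bigr do rewrite scaler_sumr.
rewrite exchange_big; apply: eq_bigr => k _; rewrite zy scaler_sumr.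
by apply: eq_bigr => l _; rewrite !scalerA mulrC.
Qed.

(** [x] acts surjectively on the finitely generated module Ext^(i+1)(T/q, T) and lies in the
    radical, so the module is zero. Nakayama is redone on the generators [z], keeping track of
    coboundaries. *)
Lemma ext_vanish_prime i q x : is_ideal q -> colon1 q x `<=` q -> jacobson x ->
  ext_vanish i.+1 (adjoin q x) -> ext_vanish i q.
Proof.
move=> Hq qx jx H e He de.
have [n [f Hf]] := noeT Hq.
have killedP m (u : 'I_1 -> E m) : (forall j, mxact f u j = 0) <-> killed q (u 0).
  split=> [fu j /(generatesP Hf)[w ->]|Hu j].
    rewrite scaler_suml big1 // => k _; have := fu k.
    by rewrite /mxact big_ord1 -scalerA => ->; rewrite scaler0.
  by rewrite /mxact big_ord1; apply: Hu; apply: generates_mem.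
have [r [z [Hz gen]]] := ext_fg i.+1 f.
have /(_ _)/cid F k : exists cu : ('I_r -> T) * E i,
    killed q cu.2 /\ z k 0 = x *: (\sum_m cu.1 m *: z m 0 + d i cu.2).
  have [||e1 [He1 de1 <-]] := ext_divisible Hq qx H (e := z k 0).
  - by apply/killedP; case: (Hz k).
  - by case: (Hz k).
  have [|c [t [[u [fu tu]] Ht]]] := gen (fun=> e1); first by split=> //; apply/killedP.
  exists (c, u 0); split; first exact/killedP.
  by rewrite (Ht 0) tu.
pose M := \matrix_(k, m) (x * (sval (F k)).1 m).
have eM k : mxact (1%:M - M) (fun m => z m 0) k = d i (x *: (sval (F k)).2).
  have [_ zk] := proj2_sig (F k).
  rewrite mxactD mxact1 mxactN [X in X - _]zk scalerDr linearZ /=.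
  have -> : mxact M (fun m => z m 0) k = x *: \sum_m (sval (F k)).1 m *: z m 0.
    by rewrite scaler_sumr; apply: eq_bigr => m _; rewrite mxE scalerA.
  by rewrite addrC addKr.
have [|N NM] := @mx_inv1B _ _ M.
  by move=> k m; rewrite mxE mulrC; apply: jacobsonM.
pose U := mxact N (fun k => x *: (sval (F k)).2).
have zU k : z k 0 = d i (U k).
  rewrite -[LHS](mxact1 (fun m => z m 0)) -NM mxactM (eq_mxact _ _ eM).
  by rewrite mxact_linear.
have HU k : killed q (U k).
  move=> j qj; rewrite scaler_sumr big1 // => m _.
  have [Hm _] := proj2_sig (F m).
  by rewrite !scalerA -mulrA mulrC -scalerA Hm // scaler0.
have [|c [t [[u [/killedP fu tu]] Ht]]] := gen (fun=> e).
  by split=> //; apply/killedP.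
exists (\sum_k c k *: U k + u 0); split.
  move=> j qj; rewrite scalerDr fu // addr0 scaler_sumr big1 // => k _.
  by rewrite scalerA mulrC -scalerA HU // scaler0.
rewrite (Ht 0) tu linearD linear_sum; congr (_ + _).
by apply: eq_bigr => k _; rewrite linearZ /= zU.
Qed.

(** For an ideal [J] maximal with nonvanishing Ext, the sequence for [J : y] moves the failure to a
    prime q. Either q is the annihilator of [s], so that T/q embeds in T and [ext_vanish_socle]
    applies, or some [x] in the radical lies outside q and [ext_vanish_prime] applies. *)
Lemma ext_descent i (s : T) : local_ring T -> s != 0 -> (forall r, jacobson r -> r * s = 0) ->
  (forall J, is_ideal J -> ext_vanish i.+1 J) -> forall J, is_ideal J -> ext_vanish i J.
Proof.
move=> locT s0 Hs H J0 HJ0; apply: contrapT => nJ0.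
have [||J [[HJ nJ] Jmax]] := @noeth_max _ noeT
    [set J | is_ideal J /\ ~ ext_vanish i J] J0.
- by move=> J [].
- by [].
apply: nJ.
have [J1|nJ1] := pselect (J 1).
  move=> e He _; exists 0; rewrite linear0 -[e]scale1r He //; split=> // j _.
  exact: scaler0.
have [y [nJy]] := ex_assoc_prime noeT HJ nJ1.
rewrite mulr1 in nJy * => -[Hq nq1 qp].
apply: (ext_vanish_short (y := y)) => //; last first.
  apply: contrapT => nA; apply: nJy.
  have <- : adjoin J y = J; last exact: adjoin_mem.
  apply: Jmax; last exact: adjoin_sub.
  by split=> //; apply: adjoin_ideal.
have prop_jac r : colon1 J y r -> jacobson r.
  move=> qr; apply: local_jacobson => // -[b rb]; apply: nq1.
  rewrite -rb; exact: ideal_mulr.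
have [jq|/existsNP[x /not_implyP[jx nqx]]] := pselect (forall r, jacobson r -> colon1 J y r).
  have -> : colon1 J y = colon1 [set 0] s; last exact: ext_vanish_socle.
  apply/seteqP; split=> r; first by move/prop_jac/Hs.
  rewrite /colon1 /= => rs; apply: jq; apply: local_jacobson => // -[b rb].
  by move/eqP: s0; apply; rewrite -[s]mul1r -rb mulrAC rs mul0r.
apply: (ext_vanish_prime (x := x)) => //; last by apply: H; apply: adjoin_ideal.
by move=> r /qp[].
Qed.

(** Baer's criterion: [D] generates an ideal J and [z] is a homomorphism from J to T. It extends
    into [E 0], and vanishing of Ext^1(T/J, T) supplies the correction, killed by J, that brings the
    extension back into the image of [eta]. *)
Lemma ext_vanish_cyclic b (D z : 'cV[T]_b) : (forall J, is_ideal J -> ext_vanish 0 J) ->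
  (forall v : 'rV_b, v *m D = 0 -> v *m z = 0) -> exists y : 'M_1, z = D *m y.
Proof.
move=> H compat.
have [|g Hg] := @injective_solve _ _ (@injE 0%N) _ _ D (fun j => eta (z j 0)).
  move=> v /compat vz; rewrite (mxact_linear v eta (fun j => z j 0 : T^o)).
  rewrite -[RHS](linear0 eta); congr (eta _).
  by have /matrixP/(_ 0 0) := vz; rewrite mxE [RHS]mxE.
have gD j : eta (z j 0) = D j 0 *: g 0 by rewrite Hg /mxact big_ord1.
pose J : set T := [set r | rowspan D r%:M].
have HJ : generates D J by [].
have [|||e [He de]] := H J _ (d 0%N (g 0)).
- exact: generates_ideal HJ.
- move=> j /(generatesP HJ)[w ->]; rewrite scaler_suml big1 // => k _.
  have /exact0 : exists m, eta m = D k 0 *: g 0 by exists (z k 0).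
  by rewrite linearZ /= -scalerA => ->; rewrite scaler0.
- exact: dd0.
have /exact0[m em] : d 0%N (g 0 - e) = 0 by rewrite linearB de subrr.
exists (m : T)%:M; apply/colP => j; apply: eta_inj.
rewrite mul_mx_scalar mxE mulrC gD.
have -> : D j 0 * m = D j 0 *: m :> T^o by [].
rewrite linearZ /= em scalerBr He ?subr0 //; exact: generates_mem HJ.
Qed.

End InjectiveResolution.

(** * Self-injective rings *)

Section SelfInjective.
Variables (T : comNzRingType) (noeT : fg_ideals T).

Definition self_injective : Prop := forall b a (D : 'M[T]_(b, a)) (z : 'cV_b),
  (forall v : 'rV_b, v *m D = 0 -> v *m z = 0) -> exists y, z = D *m y.

(** Induction on the number of unknowns: multiplying by the syzygies [N] of the last columns
    eliminates all unknowns but the first, which is the cyclic case. *)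
Lemma self_injective_cyclic :
  (forall b (D z : 'cV[T]_b), (forall v : 'rV_b, v *m D = 0 -> v *m z = 0) ->
     exists y : 'M_1, z = D *m y) -> self_injective.
Proof.
move=> H b a; elim: a b => [|a IHa] b D z compat.
  exists 0; rewrite mulmx0 -[z]mul1mx.
  by apply/row_matrixP => i; rewrite row_mul compat ?row0 // [D]thinmx0 mulmx0.
rewrite -[a.+1]/(1 + a)%N in D compat *.
rewrite -[D]hsubmxK in compat *; set D1 := lsubmx D in compat *; set D2 := rsubmx D in compat *.
have [c [N exN]] := ex_syzygies noeT D2.
have [|y1 Hy1] := H _ (N *m D1) (N *m z).
  move=> v; rewrite !mulmxA => vN; apply: compat.
  by rewrite mul_mx_row vN -mulmxA (exact_mx0 exN) mulmx0 row_mx0.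
have [|y2 Hy2] := IHa _ D2 (z - D1 *m y1).
  by move=> v /exN[w ->]; rewrite mulmxBr -!mulmxA Hy1 -!mulmxA subrr.
by exists (col_mx y1 y2); rewrite mul_row_col -Hy2 addrC subrK.
Qed.

(** Ext^(n+1) vanishes because [E n.+1] is zero; [ext_descent] lowers the degree to Ext^1, where
    Baer's criterion applies. *)
Lemma injdim_self_injective n (s : T) : local_ring T -> s != 0 ->
  (forall r, jacobson r -> r * s = 0) -> injdim_le (T^o : lmodType T) n ->
  self_injective.
Proof.
move=> locT s0 Hs [E [eta [d [[injE E0] eta_inj ex0 exS]]]].
apply: self_injective_cyclic => b D z.
move=> compat; apply: (ext_vanish_cyclic injE eta_inj ex0 exS) compat.
have: forall J, is_ideal J -> ext_vanish d n J.
  move=> J _ e _ _; exists 0; rewrite linear0 (E0 n.+1 (ltnSn n) e).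
  by split=> // j _; rewrite scaler0.
elim: n {E0} => // n IHn H; apply: IHn.
exact: (ext_descent noeT injE eta_inj ex0 exS locT s0 Hs).
Qed.

Lemma self_injective_dvd (r s : T) : self_injective ->
  (forall v, v * r = 0 -> v * s = 0) -> exists c, s = c * r.
Proof.
move=> inj H; have [|y ey] := inj 1%N 1%N r%:M s%:M.
  move=> v; rewrite [v]mx11_scalar -!scalar_mxM => e; rewrite H ?raddf0 //.
  by move/matrixP/(_ 0 0): e; rewrite !mxE eqxx.
exists (y 0 0); move/matrixP/(_ 0 0): ey.
by rewrite mul_scalar_mx !mxE eqxx mulr1n mulrC.
Qed.

(** The annihilators of the powers of [x] stabilize, so by [self_injective_dvd] some [x ^+ k] equals
    [c * x ^+ k.+1]; as [1 - c * x] is a unit, [x ^+ k] vanishes. *)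
Lemma self_injective_nilpotent (x : T) : self_injective -> jacobson x -> exists k, x ^+ k = 0.
Proof.
move=> inj jx.
have [k ann] : exists k, forall v, v * x ^+ k.+1 = 0 -> v * x ^+ k = 0.
  apply: contrapT => /forallNP H.
  have {}H k : exists v, v * x ^+ k.+1 = 0 /\ v * x ^+ k <> 0.
    by have /existsNP[v /not_implyP[]] := H k; exists v.
  have /(_ _)/cid F := H; pose y k := sval (F k).
  have [k [c ek]] := noeth_seq noeT y.
  have [_] := proj2_sig (F k); apply; rewrite -/(y k) ek mulr_suml big1 // => i _.
  have [yi _] := proj2_sig (F i).
  have -> : x ^+ k = x ^+ i.+1 * x ^+ (k - i.+1) by rewrite -exprD subnKC.
  by rewrite -mulrA [y i * _]mulrA yi mul0r mulr0.
have [c ec] := self_injective_dvd inj ann.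
exists k; have [b Hb] := jx c.
rewrite -[x ^+ k]mulr1 -Hb mulrA mulrBr mulr1.
have -> : x ^+ k * (c * x) = x ^+ k by rewrite {2}ec exprSr; ring.
by rewrite subrr mul0r.
Qed.

(** The annihilator of a nonzero [r] consists of nonunits, and these kill [s]; so [s] lies in every
    nonzero ideal. *)
Lemma self_injective_socle (s r : T) : local_ring T -> self_injective ->
  (forall c, jacobson c -> c * s = 0) -> r != 0 -> exists c, s = c * r.
Proof.
move=> locT inj Hs r0; apply: self_injective_dvd inj _ => v vr.
apply: Hs; apply: local_jacobson => // -[b vb].
by move/eqP: r0; apply; rewrite -[r]mul1r -vb mulrAC vr mul0r.
Qed.

End SelfInjective.

(** * Finite projective dimension in terms of matrices *)

Section Projective.
Variable R : comNzRingType.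

(* [rowspan D] is a projective module: [P] is a section of ['rV_b -> rowspan D]. *)
Definition projective_rowspan b a (D : 'M[R]_(b, a)) : Prop :=
  exists P : 'M_b, P *m D = D /\ forall v : 'rV_b, v *m D = 0 -> v *m P = 0.

Section Comparison.
Variables (M : lmodType R) (a n b c : nat) (q : {linear 'rV[R]_a -> M}).
Variables (D1 : 'M[R]_(n, a)) (D2 : 'M[R]_(b, n)) (D3 : 'M[R]_(c, b)).
Hypothesis q_surj : forall m, exists v, q v = m.
Hypothesis q_ker : forall v, q v = 0 <-> rowspan D1 v.
Hypotheses (ex2 : exact_mx D2 D1) (ex3 : exact_mx D3 D2).

(* The comparison maps between the matrix resolution and a projective
   resolution compose to a map homotopic to the identity; in degree three the
   homotopy yields the splitting. *)
Lemma projdim3_projective : projdim_le M 3 -> projective_rowspan D3.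
Proof.
move=> [P [eps [d [[projP P0] eps_surj ex_eps ex_d]]]].
have /(_ _)/cid F0 (l : 'I_a) := eps_surj (q (delta_mx 0 l)).
pose y0 l := sval (F0 l).
have ey0 (v : 'rV_a) : eps (mxact v y0 0) = q v.
  rewrite linear_mxact [in RHS](row_sum_delta v) linear_sum.
  rewrite /mxact;  by apply: eq_bigr => l _; rewrite linearZ /= /y0; case: (F0 l) => /= y ->.
have /(_ _)/cid F1 j : exists y, d 0%N y = mxact D1 y0 j.
  by apply/ex_eps; rewrite mxact_row ey0; apply/q_ker/rowspan_row.
pose y1 l := sval (F1 l).
have ey1 j : d 0%N (y1 j) = mxact D1 y0 j by rewrite /y1; case: (F1 j).
have /(_ _)/cid F2 j : exists y, d 1%N y = mxact D2 y1 j.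
  apply/ex_d; rewrite linear_mxact (eq_mxact _ _ ey1) -mxactM.
  by rewrite (exact_mx0 ex2) mxact0.
pose y2 l := sval (F2 l).
have ey2 j : d 1%N (y2 j) = mxact D2 y1 j by rewrite /y2; case: (F2 j).
have /(_ _)/cid F3 j : exists y, d 2%N y = mxact D3 y2 j.
  apply/ex_d; rewrite linear_mxact (eq_mxact _ _ ey2) -mxactM.
  by rewrite (exact_mx0 ex3) mxact0.
pose y3 l := sval (F3 l).
have ey3 j : d 2%N (y3 j) = mxact D3 y2 j by rewrite /y3; case: (F3 j).
have dd0 x : eps (d 0%N x) = 0 by apply/ex_eps; exists x.
have ddS i x : d i (d i.+1 x) = 0 by apply/ex_d; exists x.
have [p0 ep0] := projP 0%N _ _ q eps q_surj.
have [x|p1 ep1] := projective_lift (projP 1%N) (D := D1) (g := p0 \o d 0%N).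
  by apply/q_ker; rewrite /= ep0.
have [x|p2 ep2] := projective_lift (projP 2%N) (D := D2) (g := p1 \o d 1%N).
  by apply/ex2; rewrite ep1 /= ddS linear0.
have [x|p3 ep3] := projective_lift (projP 3%N) (D := D3) (g := p2 \o d 2%N).
  by apply/ex3; rewrite ep2 /= ddS linear0.
pose mx k i (p : P i -> 'rV[R]_k) (y : 'I_k -> P i) := \matrix_l p (y l).
have rowmxE k i (p : {linear P i -> 'rV_k}) y m (A : 'M_(m, k)) j :
    row j (A *m mx k i p y) = p (mxact A y j).
  rewrite row_mul mulmx_sum_row linear_mxact /mxact; apply: eq_bigr => l _.
  by rewrite rowK mxE.
have comm k i (p : {linear P i.+1 -> 'rV_k}) y m (p' : {linear P i -> 'rV_m}) y' D :
    (forall x, p x *m D = p' (d i x)) -> (forall j, d i (y j) = mxact D y' j) ->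
    mx k i.+1 p y *m D = D *m mx m i p' y'.
  by move=> pD yD; apply/row_matrixP => j; rewrite rowmxE row_mul rowK pD yD.
have {}comm1 := comm _ _ p1 y1 _ p0 y0 D1 ep1 ey1.
have {}comm2 := comm _ _ p2 y2 _ p1 y1 D2 ep2 ey2.
have {comm}comm3 := comm _ _ p3 y3 _ p2 y2 D3 ep3 ey3.
set A0 := mx _ _ p0 y0 in comm1; set A1 := mx _ _ p1 y1 in comm1 comm2.
set A2 := mx _ _ p2 y2 in comm2 comm3; set A3 := mx _ _ p3 y3 in comm3.
have [H0 eH0] : exists H0, A0 - 1%:M = H0 *m D1.
  apply: rowspanP => l; apply/q_ker; rewrite linearB linearB /= rowK ep0 row1.
  by rewrite -[y0 l](mxact1 y0) mxact_row row1 ey0 subrr.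
have [H1 eH1] : exists H1, A1 - 1%:M - D1 *m H0 = H1 *m D2.
  apply: (exact_mxP ex2); rewrite !mulmxBl comm1 mul1mx -mulmxA -eH0 mulmxBr mulmx1.
  by rewrite subrr.
have [H2 eH2] : exists H2, A2 - 1%:M - D2 *m H1 = H2 *m D3.
  apply: (exact_mxP ex3); rewrite !mulmxBl comm2 mul1mx -mulmxA -eH1 !mulmxBr mulmx1.
  by rewrite [D2 *m (_ *m _)]mulmxA (exact_mx0 ex2) mul0mx subr0 subrr.
(* The homotopy gives [A2 - 1%:M = D2 *m H1 + H2 *m D3]; multiplied by [D3] on the left, it shows
   that this matrix fixes [D3]. *)
exists (A3 - D3 *m H2); split.
  rewrite mulmxBl comm3 -mulmxA -eH2 !mulmxBr mulmx1 [D3 *m (_ *m _)]mulmxA.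
  by rewrite (exact_mx0 ex3) mul0mx subr0 opprB addrC subrK.
move=> v vD; rewrite mulmxBr mulmxA vD mul0mx subr0.
rewrite -[LHS](row_id 0) rowmxE; suff -> : mxact v y3 0 = 0 by rewrite linear0.
have /ex_d[y <-] : d 2%N (mxact v y3 0) = 0.
  by rewrite linear_mxact (eq_mxact _ _ ey3) -mxactM vD mxact0.
(* Length three enters here: [P 4] is zero, so [d 2] is injective and [A3] kills the kernel of
   [D3]. *)
by rewrite (P0 4%N isT y) linear0.
Qed.

End Comparison.
End Projective.

(** * Regular elements and minimal generators *)

Section RegularElements.
Variables (T : comNzRingType) (noeT : fg_ideals T).

Definition regular_mod (J : set T) a : Prop := forall y, J (a * y) -> J y.

Lemma zero_ideal : is_ideal [set (0 : T)].
Proof. by split=> // c a b /= -> ->; rewrite mulr0 addr0. Qed.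

(* If every [x + a^i], i >= 2, were a zero divisor, killing y_i <> 0, then the y_i
   would be eigenvectors of multiplication by x with eigenvalues - a^i whose
   differences are regular, hence independent, against the Noetherian condition. *)
Lemma regular_perturb (x a : T) : jacobson a -> regular_mod [set 0] a ->
  exists i, regular_mod [set 0] (x + a ^+ i.+2).
Proof.
move=> ja rega; apply: contrapT => /forallNP H.
have {H}/(_ _)/cid F i : exists y, (x + a ^+ i.+2) * y = 0 /\ y <> 0.
  by have /existsNP[y /not_implyP[]] := H i; exists y.
pose y i := sval (F i).
have regX n z : a ^+ n * z = 0 -> z = 0.
  elim: n => [|n IHn]; first by rewrite expr0 mul1r.
  by rewrite exprS -mulrA => /rega/IHn.
have indep i k z : (i < k)%N -> (x + a ^+ i.+2) * z = 0 -> (x + a ^+ k.+2) * z = 0 -> z = 0.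
  move=> ik ei ek.
  have [b Hb] := ja (a ^+ (k - i.+1)).
  have : a ^+ i.+2 * ((1 - a ^+ (k - i.+1) * a) * z) = 0.
    rewrite -exprSr mulrA mulrBr mulr1 -exprD.
    have -> : (i.+2 + (k - i.+1).+1 = k.+2)%N by rewrite addnS !addSn -addSn subnKC.
    by rewrite -[RHS](subrr 0) -{1}ei -{1}ek; ring.
  by move/regX => e; rewrite -[z]mul1r -Hb [_ * b]mulrC -mulrA e mulr0.
have [k [c ek]] := noeth_seq noeT y.
have [yk nyk] := proj2_sig (F k); apply: nyk; rewrite -/(y k).
have kill : \prod_(i < k) (x + a ^+ i.+2) * y k = 0.
  rewrite ek mulr_sumr big1 // => i _; rewrite (bigD1 i) //=.
  have [yi _] := proj2_sig (F i).
  set P := \prod_(_ < _ | _) _.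
  transitivity (P * c i * ((x + a ^+ i.+2) * y i)); first by ring.
  by rewrite yi mulr0.
(* [indep] strips one factor at a time, since [y k] is also killed by the factor of index [k]. *)
have step m : (m <= k)%N -> \prod_(i < m) (x + a ^+ i.+2) * y k = 0 -> y k = 0.
  elim: m => [|m IHm] mk; first by rewrite big_ord0 mul1r.
  rewrite big_ord_recr /= => e; apply: IHm; first exact: ltnW.
  apply: (indep _ _ _ mk); first by rewrite mulrCA mulrA.
  by rewrite mulrCA yk mulr0.
exact: step (leqnn k) kill.
Qed.

(** Regular sequences in the radical can be permuted. The elements that [b] multiplies into [B] form
    an ideal N contained in aN + B, so Nakayama puts N inside [B]. *)
Lemma regular_mod_swap (B : set T) a b : is_ideal B -> jacobson a ->
  regular_mod B a -> regular_mod (adjoin B a) b ->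
  regular_mod B b /\ regular_mod (adjoin B b) a.
Proof.
move=> HB ja rega regb; split.
  pose N : set T := [set y | B (b * y)].
  suff : N `<=` B by move=> NB y; apply: NB.
  apply: nakayama => //.
    split; first by rewrite /N /= mulr0; case: HB.
    move=> c u v Nu Nv; rewrite /N /=.
    have -> : b * (c * u + v) = c * (b * u) + b * v by ring.
    by case: HB => _; apply.
  move=> y Ny; have [|j [c [Bj ey]]] := regb y; first exact: adjoin_sub.
  exists a, c, j; split=> //; last by rewrite ey addrC mulrC.
  apply: rega; rewrite /N.
  have -> : a * (b * c) = b * y - b * j by rewrite ey; ring.
  by apply: ideal_sub => //; apply: ideal_mull.
move=> y [j [z [Bj ey]]].
have [|j' [c [Bj' ez]]] := regb z.
  by exists (- j), y; split; [apply: ideal_opp | rewrite mulrC [y * a]mulrC ey; ring].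
exists (y - c * b), c; split; last by rewrite subrK.
apply: rega; have -> : a * (y - c * b) = j + b * j' by rewrite mulrBr ey ez; ring.
by apply: ideal_add => //; apply: ideal_mull.
Qed.

End RegularElements.

(** * Minimal generators over a local ring *)

Section MinimalGenerators.
Variables (T : comNzRingType) (locT : local_ring T).

Definition minimal_rows b a (D : 'M[T]_(b, a)) : Prop :=
  forall b' (D' : 'M[T]_(b', a)), rowspan D' = rowspan D -> (b <= b')%N.

Lemma ex_minimal_rows b a (D : 'M[T]_(b, a)) :
  exists b' (D' : 'M[T]_(b', a)), rowspan D' = rowspan D /\ minimal_rows D'.
Proof.
pose p k := `[< exists D' : 'M[T]_(k, a), rowspan D' = rowspan D >].
have ex : exists k, p k by exists b; apply/asboolP; exists D.
case: (ex_minnP ex) => k /asboolP[D' eD'] mink; exists k, D'; split=> // b' D'' e.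
by apply: mink; apply/asboolP; exists D''; rewrite e.
Qed.

(** A unit coefficient would express one row through the others. *)
Lemma minimal_rows_syzygy b a (D : 'M[T]_(b, a)) (v : 'rV_b) :
  minimal_rows D -> v *m D = 0 -> forall i, jacobson (v 0 i).
Proof.
case: b D v => [|b] D v minD vD i; first by case: i.
apply: local_jacobson => // -[u vu].
suff : (b.+1 <= b)%N by rewrite ltnn.
apply: (minD _ (row' i D)); apply/seteqP; split=> [_ [w ->]|_ [w ->]].
  apply: submod_mulmx; first exact: rowspan_submod.
  move=> j; have -> : row j (row' i D) = row (lift i j) D by apply/rowP => l; rewrite !mxE.
  exact: rowspan_row.
have HS := rowspan_submod (row' i D).
have Hlift j : rowspan (row' i D) (row (lift i j) D).
  have -> : row (lift i j) D = row j (row' i D) by apply/rowP => l; rewrite !mxE.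
  exact: rowspan_row.
apply: submod_mulmx => // k; case: (unliftP i k) => [j ->|->] //.
have -> : row i D = (- u) *: \sum_(j < b) v 0 (lift i j) *: row (lift i j) D.
  move: vD; rewrite mulmx_sum_row (bigD1_ord i) //= => /eqP; rewrite addr_eq0 => /eqP e.
  by rewrite scaleNr -scalerN -e scalerA mulrC vu scale1r.
apply: submodZ => //; elim/big_ind: _ => //; first by case: HS.
- by move=> x y; apply: submodD.
- by move=> j _; apply: submodZ.
Qed.

(** Projective modules over a local ring are free: the rows of [1%:M - P] are syzygies, so they lie
    in the radical and [P] is invertible, yet [P] kills every syzygy of [D]. *)
Lemma minimal_projective_inj b a (D : 'M[T]_(b, a)) : minimal_rows D ->
  projective_rowspan D -> forall v : 'rV_b, v *m D = 0 -> v = 0.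
Proof.
move=> minD [P [PD Pker]] v vD.
have [|N HN] := @mx_inv1Br _ _ (1%:M - P).
  move=> i j; have := minimal_rows_syzygy (v := row i (1%:M - P)) minD _ j.
  rewrite [_ 0 j]mxE; apply; rewrite -row_mul mulmxBl mul1mx PD subrr row0 //.
rewrite opprB addrC subrK in HN.
by rewrite -[v]mulmx1 -HN mulmxA Pker // mul0mx.
Qed.

End MinimalGenerators.

Section Retract.
Variable T : comNzRingType.

(* [M = coker D2] has projective dimension at most 2, and [A = T/I] is a retract
   of [M] through [e : A -> M] and [y : M -> A]; hence [A] has projective dimension
   at most 2 as well.  The comparison maps of resolutions give the splitting. *)
Lemma retract_projective (I : set T) n b c (D2 : 'M[T]_(b, n)) (D3 : 'M_(c, b))
    (e : 'rV_n) (y : 'cV_n) m (g : 'cV_m) k (G : 'M_(k, m)) :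
  generates g I -> exact_mx G g -> exact_mx D3 D2 -> projective_rowspan D3 ->
  (forall r, I r -> rowspan D2 (r *: e)) ->
  (forall i, I ((D2 *m y) i 0)) -> I (1 - (e *m y) 0 0) -> projective_rowspan G.
Proof.
move=> Hg exG exD [Q [QD Qker]] HA HB HC.
have [al1 eal1] : exists X, g *m e = X *m D2.
  apply: rowspanP => i; rewrite row_mul [row i g]mx11_scalar mul_scalar_mx mxE.
  by apply: HA; apply: generates_mem Hg.
have [be1 ebe1] : exists X, D2 *m y = X *m g.
  apply: rowspanP => i; rewrite [row i _]mx11_scalar mxE.
  exact/Hg.
have [h0 eh0] : exists X, 1%:M - e *m y = X *m g.
  apply: rowspanP => i; rewrite [row i _]mx11_scalar; apply/Hg.
  by rewrite ord1 !mxE; move: HC; rewrite mxE.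
have [al2 eal2] : exists X, G *m al1 = X *m D3.
  apply: (exact_mxP exD); rewrite -mulmxA -eal1 mulmxA (exact_mx0 exG) mul0mx //.
have [be2 ebe2] : exists X, D3 *m be1 = X *m G.
  apply: (exact_mxP exG); rewrite -mulmxA -ebe1 mulmxA (exact_mx0 exD) mul0mx //.
have [h1 eh1] : exists X, 1%:M - al1 *m be1 - g *m h0 = X *m G.
  apply: (exact_mxP exG); rewrite !mulmxBl -!mulmxA -ebe1 -eh0 mul1mx mulmxBr mulmx1.
  by rewrite [al1 *m _]mulmxA -eal1 -mulmxA opprB addrA subrK subrr.
(* The first term transports the splitting [Q] along the comparison maps; the homotopy term
   [G *m h1] makes up the difference from the identity on the row span of [G]. *)
exists (al2 *m Q *m be2 + G *m h1); split.
  rewrite mulmxDl -!mulmxA -eh1 -ebe2 [Q *m _]mulmxA QD !mulmxBr mulmx1 mulmxA -eal2.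
  by rewrite !mulmxA (exact_mx0 exG) !mul0mx subr0 addrC subrK.
move=> v vG; rewrite mulmxDr !mulmxA vG mul0mx addr0 Qker ?mul0mx //.
by rewrite -mulmxA -eal2 mulmxA vG mul0mx.
Qed.

End Retract.

(** * Gorenstein quotients of projective dimension two *)

Section CodimTwo.
Variables (T : comNzRingType) (noeT : fg_ideals T) (locT : local_ring T).
Variables (J : set T) (m k : nat) (g : 'cV[T]_m) (G : 'M[T]_(k, m)) (a b s : T).
Hypotheses (Hg : generates g J) (exG : exact_mx G g).
Hypothesis G_inj : forall v : 'rV_k, v *m G = 0 -> v = 0.
Hypothesis G_jac : forall i j, jacobson (G i j).
Hypotheses (Ja : J a) (Jb : J b) (rega : regular_mod [set 0] a).
Hypothesis regb : regular_mod (adjoin [set 0] a) b.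

Let B := adjoin (adjoin [set 0] a) b.

Lemma adjoin0P (x r : T) : adjoin [set 0] x r <-> exists c, r = c * x.
Proof.
split=> [[_ [c [-> ->]]]|[c ->]]; first by exists c; rewrite add0r.
by exists 0, c; rewrite add0r.
Qed.

Lemma adjoin2P (x y r : T) :
  adjoin (adjoin [set 0] x) y r <-> exists c d, r = c * x + d * y.
Proof.
split=> [[j [d [/adjoin0P[c ->] ->]]]|[c [d ->]]]; first by exists c, d.
by exists (c * x), d; split=> //; apply/adjoin0P; exists c.
Qed.

Lemma B_ideal : is_ideal B.
Proof. by apply/adjoin_ideal/adjoin_ideal/zero_ideal. Qed.

Lemma row_adjoin2 n (x : 'rV[T]_n) : (forall i, B (x 0 i)) ->
  exists u v, x = a *: u + b *: v.
Proof.
move=> H; have /(_ _)/cid F i : exists p, x 0 i = p.1 * a + p.2 * b.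
  by have /adjoin2P[c [d ->]] := H i; exists (c, d).
exists (\row_i (sval (F i)).1), (\row_i (sval (F i)).2); apply/rowP => i.
by apply: etrans (proj2_sig (F i)) _; rewrite !mxE mulrC [b * _]mulrC.
Qed.

(* The correspondence between [A = T/J] and the kernel of [G] over [T/(a, b)];
   both are [Tor_2(A, T/(a, b))]. *)
Definition tor_rel (w : 'rV[T]_k) (r : T) : Prop := exists u v : 'rV_m,
  [/\ w *m G = a *: u + b *: v, u *m g = (b * r)%:M & v *m g = (- (a * r))%:M].

Lemma tor_relB c w r w' r' :
  tor_rel w r -> tor_rel w' r' -> tor_rel (w - c *: w') (r - c * r').
Proof.
move=> [u [v [e1 e2 e3]]] [u' [v' [e1' e2' e3']]].
exists (u - c *: u'), (v - c *: v'); split.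
- rewrite mulmxBl -scalemxAl e1 e1' !scalerBr scalerDr !scalerA.
  by rewrite [c * a]mulrC [c * b]mulrC opprD addrACA.
- rewrite mulmxBl -scalemxAl e2 e2' scale_scalar_mx -raddfB /=; congr (_%:M); ring.
- rewrite mulmxBl -scalemxAl e3 e3' scale_scalar_mx -raddfB /=; congr (_%:M); ring.
Qed.

Lemma tor_rel0 : tor_rel 0 0.
Proof. by exists 0, 0; rewrite !mul0mx !scaler0 !mulr0 oppr0 addr0 raddf0. Qed.

Lemma tor_relZ c w r : tor_rel w r -> tor_rel (c *: w) (c * r).
Proof.
by move=> /(tor_relB (- c) tor_rel0); rewrite !sub0r mulNr scaleNr !opprK.
Qed.

(** This and the next three lemmas make [tor_rel] a bijection between T/J and the kernel of [G]
    modulo (a, b): every element on either side is related to one on the other, and membership in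
    [J] corresponds to vanishing modulo (a, b). *)
Lemma tor_rel_right r : exists w, tor_rel w r.
Proof.
have HJ := generates_ideal Hg.
have /Hg[u eu] := ideal_mulr r HJ Jb.
have /Hg[v ev] := ideal_opp HJ (ideal_mulr r HJ Ja).
have /exG[w ew] : (a *: u + b *: v) *m g = 0.
  rewrite mulmxDl -!scalemxAl -eu -ev !scale_scalar_mx -raddfD /=.
  by rewrite (_ : _ + _ = 0) ?raddf0 //; ring.
by exists w, u, v.
Qed.

Lemma tor_rel_left (w : 'rV_k) : (forall i, B ((w *m G) 0 i)) -> exists r, tor_rel w r.
Proof.
move=> /row_adjoin2[u [v e1]].
pose p := (u *m g) 0 0; pose q := (v *m g) 0 0.
have epq : a * p + b * q = 0.
  have /matrixP/(_ 0 0) : (w *m G) *m g = 0 by rewrite -mulmxA (exact_mx0 exG) mulmx0.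
  by rewrite e1 mulmxDl -!scalemxAl mxE [X in X + _]mxE [X in _ + X]mxE [RHS]mxE.
have /adjoin0P[c ec] : adjoin [set 0] a q.
  apply: regb; apply/adjoin0P; exists (- p); apply/eqP.
  by rewrite mulNr -addr_eq0 addrC mulrC epq.
have ep : p = - (b * c).
  apply/eqP; rewrite -addr_eq0; apply/eqP/rega => /=.
  by rewrite -epq ec; ring.
exists (- c), u, v; split=> //; apply/mx11E.
  by rewrite -/p ep mulrN.
by rewrite -/q ec mulrN opprK mulrC.
Qed.

Lemma tor_rel_J w r : tor_rel w r -> J r -> forall i, B (w 0 i).
Proof.
move=> [u [v [ew eu ev]]] /Hg[rho er].
have /exG[u' eu'] : (u - b *: rho) *m g = 0.
  by rewrite mulmxBl -scalemxAl eu -er scale_scalar_mx subrr.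
have /exG[v' ev'] : (v + a *: rho) *m g = 0.
  by rewrite mulmxDl -scalemxAl ev -er scale_scalar_mx -raddfD /= addNr raddf0.
have -> : w = a *: u' + b *: v'.
  apply/eqP; rewrite -subr_eq0; apply/eqP/G_inj.
  rewrite mulmxBl mulmxDl -!scalemxAl -eu' -ev' ew scalerBr scalerDr !scalerA.
  by rewrite [b * a]mulrC addrACA addNr addr0 subrr.
by move=> i; apply/adjoin2P; exists (u' 0 i), (v' 0 i); rewrite !mxE mulrC [b * _]mulrC.
Qed.

Lemma tor_rel_B w r : tor_rel w r -> (forall i, B (w 0 i)) -> J r.
Proof.
have HJ := generates_ideal Hg.
move=> [u [v [ew eu ev]]] /row_adjoin2[w1 [w2 e1]].
have e0 : a *: (u - w1 *m G) + b *: (v - w2 *m G) = 0.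
  rewrite !scalerBr addrACA -ew e1 mulmxDl -!scalemxAl -opprD subrr //.
have [rho erho] : exists rho, v - w2 *m G = a *: rho.
  have /(_ _)/cid H i : exists c, (v - w2 *m G) 0 i = c * a.
    apply/adjoin0P; apply: regb; apply/adjoin0P; exists (- (u - w1 *m G) 0 i).
    move/rowP/(_ i): e0; rewrite mxE [X in X + _]mxE [X in _ + X]mxE [RHS]mxE => /eqP.
    by rewrite addrC addr_eq0 => /eqP ->; rewrite mulNr mulrC.
  exists (\row_i sval (H i)); apply/rowP => i.
  by apply: etrans (proj2_sig (H i)) _; rewrite [RHS]mxE [X in a * X]mxE mulrC.
have ev2 : v = w2 *m G + a *: rho by rewrite -erho addrC subrK.
have er : r = - (rho *m g) 0 0.
  apply/eqP; rewrite -addr_eq0; apply/eqP/rega => /=.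
  move: ev; rewrite ev2 mulmxDl -mulmxA (exact_mx0 exG) mulmx0 add0r -scalemxAl.
  by move/matrixP/(_ 0 0); rewrite mxE [RHS]mxE eqxx mulr1n mulrDr => ->; rewrite subrr.
rewrite er; apply: ideal_opp => //; apply/Hg; exists rho; symmetry.
exact/mx11E.
Qed.

Hypotheses (nJs : ~ J s) (socJ : forall c, jacobson c -> J (c * s)).
Hypothesis simple : forall r, ~ J r -> exists c, J (s - c * r).

(** A row related to [s] has an entry [sg] outside [B] that the radical multiplies into [B]. As [G]
    has entries in the radical, every [sg *: delta_mx 0 i] is related to some [r i] outside [J].
    Simplicity of the socle makes any two [r i] proportional modulo [J] by units, which distinct
    basis vectors forbid. *)
Lemma relations_rank1 : k = 1%N.
Proof.
have HJ := generates_ideal Hg.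
have [w ws] := tor_rel_right s.
have /existsNP[i0 nBw] : ~ forall i, B (w 0 i) by move/(tor_rel_B ws).
pose sg := w 0 i0.
have Bsg c : jacobson c -> B (c * sg).
  move=> jc; have := tor_rel_J (tor_relZ c ws) (socJ jc).
  by move/(_ i0); rewrite mxE.
have /(_ _)/cid F i : exists r, tor_rel (sg *: delta_mx 0 i) r.
  apply: tor_rel_left => j; rewrite -scalemxAl -rowE !mxE mulrC.
  by apply: Bsg.
pose r i := sval (F i).
have Hr i : tor_rel (sg *: delta_mx 0 i) (r i) by rewrite /r; case: (F i).
have nJr i : ~ J (r i).
  move/(tor_rel_J (Hr i))/(_ i); rewrite !mxE !eqxx mulr1; exact: nBw.
have /(_ _)/cid C i := simple (@nJr i).
have invc i : invertible (sval (C i)).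
  case: (locT (sval (C i))) => // jc; case: nJs.
  have : J (sval (C i) * r i).
    apply: (tor_rel_B (tor_relZ _ (Hr i))) => j.
    rewrite scalerA !mxE; apply: ideal_mulr; first exact: B_ideal.
    exact: Bsg.
  by move/(ideal_add HJ (proj2_sig (C i))); rewrite subrK.
have uniq i : i = i0.
  apply: contrapT => ni.
  pose c := sval (C i); pose c0 := sval (C i0).
  have H := tor_relB c (tor_relZ c0 (Hr i0)) (Hr i); apply: nBw.
  have [d Hd] := invc i0.
  rewrite -/sg -[sg]mul1r -Hd mulrAC; apply: ideal_mulr; first exact: B_ideal.
  have : B ((c0 *: (sg *: delta_mx 0 i0) - c *: (sg *: delta_mx 0 i) : 'rV_k) 0 i0).
    apply: (tor_rel_J H); have -> : c0 * r i0 - c * r i = (s - c * r i) - (s - c0 * r i0) by ring.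
    by apply: ideal_sub => //; [exact: proj2_sig (C i)|exact: proj2_sig (C i0)].
  rewrite !mxE !eqxx /= (negPf _ : i0 == i = false) ?mulr0 ?subr0 ?mulr1 //.
  by apply/eqP => e; apply: ni.
have : (k <= 1)%N.
  rewrite -[k]card_ord; apply/card_le1P => x _ y; rewrite inE.
  by rewrite !inE (uniq x) (uniq y) eqxx.
by case: (k) (i0) => [[]//|[|[]]].
Qed.

End CodimTwo.

(** * Codimension two ideals with a single relation *)

Section RankOne.
Variable T : comNzRingType.

(** The leading 3 by 3 minor is [a ^+ 3] on the left and vanishes on the right, a sum of two
    matrices of rank one. *)
Lemma scalar_mx_rank2 m (a : T) (g t : 'cV_m) (u c : 'rV_m) :
  a%:M = g *m u + t *m c -> (2 < m)%N -> a ^+ 3 = 0.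
Proof.
move=> e m2.
have E i j : (i == j)%:R * a = g i 0 * u 0 j + t i 0 * c 0 j.
  rewrite mulr_natl; have <- : (a%:M : 'M_m) i j = a *+ (i == j) by rewrite mxE.
  by rewrite e mxE [X in X + _]mxE [X in _ + X]mxE !big_ord1.
pose i0 := Ordinal (ltn_trans (isT : 0 < 2)%N m2).
pose i1 := Ordinal (ltn_trans (isT : 1 < 2)%N m2).
pose i2 := Ordinal m2.
have := (E i0 i0, E i0 i1, E i0 i2, (E i1 i0, E i1 i1, E i1 i2),
         (E i2 i0, E i2 i1, E i2 i2)).
rewrite /= !mul1r !mul0r => -[[[[[e00 e01] e02] [[e10 e11] e12]] [[e20 e21] e22]]].
pose f i j := g i 0 * u 0 j + t i 0 * c 0 j.
have det0 : f i0 i0 * (f i1 i1 * f i2 i2 - f i1 i2 * f i2 i1)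
  - f i0 i1 * (f i1 i0 * f i2 i2 - f i1 i2 * f i2 i0)
  + f i0 i2 * (f i1 i0 * f i2 i1 - f i1 i1 * f i2 i0) = 0 by rewrite /f; ring.
rewrite /f -e00 -e01 -e02 -e10 -e11 -e12 -e20 -e21 -e22 in det0.
by rewrite -[RHS]det0; ring.
Qed.
End RankOne.

Lemma sum_ord2 (V : nmodType) (F : 'I_2 -> V) : \sum_i F i = F 0 + F 1.
Proof. by rewrite big_ord_recl big_ord1; congr (_ + F _); apply: val_inj. Qed.

Section CodimTwoEnd.
Variables (T : comNzRingType) (noeT : fg_ideals T) (locT : local_ring T).
Variables (J : set T) (a b : T).
Hypotheses (Jjac : J `<=` @jacobson T).
Hypotheses (Ja : J a) (Jb : J b) (rega : regular_mod [set 0] a).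
Hypothesis regb : regular_mod (adjoin [set 0] a) b.

(* Writing [a = al *m g], the matrix [a%:M - g *m al] kills [g], hence equals
   [tau *m C]; so the scalar matrix [a] has rank at most two and [m <= 2]. *)
Lemma cyclic_relations_ci m (g : 'cV[T]_m) (C : 'rV[T]_m) :
  generates g J -> exact_mx C g -> (forall t : 'M_1, t *m C = 0 -> t = 0) ->
  exists y z, [/\ forall r, J r <-> exists u v, r = u * y + v * z,
    regular_mod [set 0] y & regular_mod (adjoin [set 0] y) z].
Proof.
move=> Hg exC C_inj.
have a_neq0 : a <> 0.
  by move=> a0; have /eqP := rega (y := 1) (etrans (mulr1 a) a0); rewrite oner_eq0.
have C_neq0 : C <> 0.
  move=> C0; have /matrixP/(_ 0 0)/eqP := C_inj 1%:M (etrans (congr1 _ C0) (mulmx0 _ _)).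
  by rewrite !mxE oner_eq0.
have /Hg[al eal] := Ja.
have [tau etau] : exists X, a%:M - g *m al = X *m C.
  by apply: (exact_mxP exC); rewrite mulmxBl -mulmxA -eal mul_scalar_mx mul_mx_scalar subrr.
have m2 : (m <= 2)%N.
  rewrite leqNgt; apply/negP => m3; apply: a_neq0.
  have : a ^+ 3 = 0.
    apply: (scalar_mx_rank2 (g := g) (t := tau) (u := al) (c := C)) m3.
    by rewrite -etau addrC subrK.
  by rewrite !exprS expr0 mulr1 => /rega/rega.
case: m g C Hg exC C_inj C_neq0 al eal tau etau m2 => [|[|[|//]]]
    g C Hg exC C_inj C_neq0 al eal tau etau _.
- by case: C_neq0; apply/rowP; case.
- case: C_neq0; have := exact_mx0 exC; rewrite [C]mx11_scalar => /matrixP/(_ 0 0).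
  rewrite mul_scalar_mx mxE [RHS]mxE => e.
  suff -> : C 0 0 = 0 by rewrite raddf0.
  apply: rega => /=; move/matrixP/(_ 0 0): eal; rewrite [LHS]mxE eqxx mulr1n => ->.
  by rewrite mxE big_ord1 -mulrA [g 0 0 * _]mulrC e mulr0.
set y := g 0 0; set z := g 1 0.
have genJ r : J r <-> exists u v, r = u * y + v * z.
  rewrite (generatesP Hg); split=> [[w ->]|[u [v ->]]].
    by exists (w 0 0), (w 0 1); rewrite sum_ord2.
  by exists (\row_(i < 2) if i == 0 then u else v); rewrite sum_ord2 !mxE.
have relP u v : u * y + v * z = 0 -> exists t, u = t * C 0 0 /\ v = t * C 0 1.
  move=> e; have /exC[t et] : (\row_(i < 2) if i == 0 then u else v) *m g = 0.
    by apply/matrixP => i j; rewrite !ord1 mxE sum_ord2 !mxE -[RHS]e.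
  exists (t 0 0); split.
    by have /rowP/(_ 0) := et; rewrite !mxE big_ord1.
  by have /rowP/(_ 1) := et; rewrite !mxE big_ord1.
(* The Koszul relation between [y] and [z] is a multiple [t] of the generating relation [C], so [t]
   is a common factor of all of [J]. *)
have [t [ez ey]] : exists t, z = t * C 0 0 /\ - y = t * C 0 1.
  by apply: relP; ring.
have Jt r : J r -> exists r', r = t * r'.
  move=> /genJ[u [v ->]]; exists (v * C 0 0 - u * C 0 1).
  by rewrite ez -[y]opprK ey; ring.
(* A regular sequence [a], [b] has no common factor in the radical: regularity of [b] makes [a'] a
   multiple [r * a], whence [a = r * t * a] and [a] is zero. *)
have [d td] : invertible t.
  case: (locT t) => // jt; case: a_neq0.
  have [a' ea] := Jt _ Ja; have [b' eb] := Jt _ Jb.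
  have /adjoin0P[r er] : adjoin [set 0] a a'.
    by apply: regb; apply/adjoin0P; exists b'; rewrite ea eb; ring.
  have [i Hi] := jt r.
  have : (1 - r * t) * a = 0 by rewrite mulrBl mul1r {1}ea er; ring.
  by move=> e; rewrite -[a]mul1r -Hi mulrAC e mul0r.
have relP' u v : u * y + v * z = 0 -> exists q, u = q * z /\ v = - (q * y).
  move=> /relP[q [-> ->]]; exists (q * d); split.
    by rewrite ez mulrA -(mulrA q) [d * t]mulrC td mulr1.
  by rewrite -mulrN ey mulrA -(mulrA q) [d * t]mulrC td mulr1.
exists y, z; split=> //.
  (* Only Koszul relations remain, so a [v] with [y * v = 0] is [q * z] with [q] again killed by
     [y]; Nakayama applies because [z] is in the radical. *)
  suff H : [set v | y * v = 0] `<=` [set (0 : T)] by move=> v /H.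
  apply: nakayama => //; [|exact: zero_ideal|].
    by split=> [|c u v /= eu ev]; rewrite /= ?mulr0 // mulrDr mulrCA eu ev mulr0 addr0.
  move=> v /= yv; have [|q [-> eq]] := relP' v 0; first by rewrite mul0r addr0 mulrC.
  exists z, q, 0; split=> //; last by rewrite addr0 mulrC.
    by apply: Jjac; apply: generates_mem Hg.
  by rewrite mulrC -[LHS]opprK -eq oppr0.
move=> w /adjoin0P[c ec].
have [|q [_ ->]] := relP' (- c) w; first by rewrite mulNr -ec; ring.
by apply/adjoin0P; exists (- q); rewrite mulNr.
Qed.

(** Projectivity is assumed for every presentation because minimal generators and minimal relations
    are only chosen inside the proof. *)
Lemma gorenstein_codim2_ci n (f : 'cV[T]_n) s :
  generates f J ->
  (forall m (g : 'cV[T]_m) k (G : 'M_(k, m)), generates g J -> exact_mx G g ->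
     projective_rowspan G) ->
  ~ J s -> (forall c, jacobson c -> J (c * s)) ->
  (forall r, ~ J r -> exists c, J (s - c * r)) ->
  exists y z, [/\ forall r, J r <-> exists u v, r = u * y + v * z,
    regular_mod [set 0] y & regular_mod (adjoin [set 0] y) z].
Proof.
move=> Hf Hproj nJs socJ simple.
have [m [g [eg ming]]] := ex_minimal_rows f.
have Hg : generates g J by move=> r; rewrite eg.
have [k0 [G0 exG0]] := ex_syzygies noeT g.
have [k [G [eG minG]]] := ex_minimal_rows G0.
have exG : exact_mx G g by move=> v; rewrite eG.
have G_inj := minimal_projective_inj locT minG (Hproj _ _ _ _ Hg exG).
have G_jac i j : jacobson (G i j).
  have := minimal_rows_syzygy locT (v := row i G) ming _ j; rewrite mxE; apply.
  by rewrite -row_mul (exact_mx0 exG) row0.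
have k1 := relations_rank1 locT Hg exG G_inj G_jac Ja Jb rega regb nJs socJ simple.
subst k; exact: cyclic_relations_ci Hg exG G_inj.
Qed.

End CodimTwoEnd.

(** * Quotient rings and ring maps *)

Section RingMaps.
Variables (R S : comNzRingType) (h : {rmorphism R -> S}).

(** The hypothesis says that every [s] generates the same ideal as some [h r], which covers quotient
    maps and localizations alike. *)
Lemma fg_ideals_image :
  (forall s, exists r u v, s * u = h r /\ s = h r * v) -> fg_ideals R -> fg_ideals S.
Proof.
move=> frac noeR J HJ.
have [|n [f Hf]] := noeR [set r | J (h r)].
  split; first by rewrite /= rmorph0; case: HJ.
  by move=> c a b Ja Jb; rewrite /= rmorphD rmorphM; case: HJ => _; apply.
exists n, (map_mx h f) => s; split=> [Js|[w /esym/mx11E <-]]; last first.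
  rewrite mxE; apply: ideal_sum => // i; apply: ideal_mull => //; rewrite mxE.
  exact: (generates_mem i Hf).
have [r [u [v [su sr]]]] := frac s.
have /Hf[w ew] : [set r | J (h r)] r by rewrite /= -su; apply: ideal_mulr.
exists (v *: map_mx h w); rewrite -scalemxAl -map_mxM -ew map_scalar_mx /=.
by rewrite scale_scalar_mx mulrC -sr.
Qed.

Hypothesis h_surj : forall s, exists r, h r = s.

Lemma fg_ideals_surj : fg_ideals R -> fg_ideals S.
Proof.
apply: fg_ideals_image => s; have [r <-] := h_surj s.
by exists r, 1, 1; rewrite mulr1.
Qed.

Lemma invertible_morph a : invertible a -> invertible (h a).
Proof. by move=> [b ab]; exists (h b); rewrite -rmorphM ab rmorph1. Qed.

Lemma jacobson_surj a : jacobson a -> jacobson (h a).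
Proof.
move=> ja c; have [d <-] := h_surj c.
by have := invertible_morph (ja d); rewrite rmorphB rmorph1 rmorphM.
Qed.

Lemma local_ring_surj : local_ring R -> local_ring S.
Proof.
move=> locR s; have [r <-] := h_surj s.
by case: (locR r) => [/invertible_morph|/jacobson_surj]; [left|right].
Qed.

Lemma jacobson_lift a : local_ring R -> jacobson (h a) -> jacobson a.
Proof. by move=> /(_ a)[/invertible_morph/[swap]/jacobson_ninv|]. Qed.

Lemma generates_image n (f : 'cV_n) I :
  generates f I -> generates (map_mx h f) (h @` I).
Proof.
move=> Hf s; split=> [[r /Hf[w ew] <-]|[w ew]].
  by exists (map_mx h w); rewrite -map_mxM -ew map_scalar_mx.
have /(_ _)/cid F i := h_surj (w 0 i).
pose w' := \row_i sval (F i).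
have ew' : w = map_mx h w' by apply/rowP => i; rewrite !mxE; case: (F i).
exists ((w' *m f) 0 0).
  by apply/Hf; exists w'; symmetry; apply/mx11E.
move/matrixP/(_ 0 0): ew; rewrite ew' -map_mxM mxE eqxx mulr1n => ->.
by rewrite [RHS]mxE.
Qed.

Variable K : set R.
Hypothesis h_ker : forall r, h r = 0 <-> K r.

Lemma regular_mod_preim (L : set S) a :
  regular_mod [set r | L (h r)] a <-> regular_mod L (h a).
Proof.
split=> [H s|H r /=]; last by rewrite rmorphM; apply: H.
by have [r <-] := h_surj s; rewrite -rmorphM; apply: (H r).
Qed.

Lemma preim_zero : [set r | [set 0] (h r)] = K.
Proof. by apply/seteqP; split=> r /h_ker. Qed.

Lemma preim_adjoin y : [set r | adjoin [set 0] (h y) (h r)] = adjoin K y.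
Proof.
apply/seteqP; split=> r /=.
  move=> /adjoin0P[c]; have [d <-] := h_surj c => e.
  exists (r - d * y), d; rewrite subrK; split=> //.
  by apply/h_ker; rewrite rmorphB rmorphM e subrr.
by move=> [j [c [/h_ker Kj ->]]]; apply/adjoin0P; exists (h c); rewrite rmorphD rmorphM Kj add0r.
Qed.

End RingMaps.

Lemma ex_quotient_ring (T : comNzRingType) (J : set T) : is_ideal J -> ~ J 1 ->
  exists (S : comNzRingType) (h : {rmorphism T -> S}),
    (forall s, exists r, h r = s) /\ forall r, h r = 0 <-> J r.
Proof.
move=> HJ nJ1.
pose p : T -> bool := fun r => `[< J r >].
have p_closed : idealr_closed p.
  split; first by apply/asboolP; case: HJ.
    by apply/asboolP.
  by move=> c a b /asboolP Ja /asboolP Jb; apply/asboolP; case: HJ => _; apply.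
pose pI := isIdealr.Build T p p_closed.
pose I : idealr T := HB.pack p pI.
exists ({ideal_quot I} : comNzRingType), (\pi_{ideal_quot I}%qT : {rmorphism T -> {ideal_quot I}}).
split=> [s|r].
  by exists (repr s); rewrite /= reprK.
have : (r - 0 \in I) = `[< J r >] by rewrite subr0.
rewrite Quotient.idealrBE => e; split=> [h0|Jr].
  by apply/asboolP; rewrite -e; apply/eqP; apply: etrans h0 (esym (rmorph0 _)).
by move: e; rewrite (asboolT Jr) => /eqP e; apply: etrans e (rmorph0 _).
Qed.

Lemma ideal_gen_ideal (T : comNzRingType) (S : set T) : is_ideal (ideal_gen S).
Proof.
split; first by exists 0%N, (fun=> 0), (fun=> 0); rewrite big_ord0; split=> // -[].
move=> r _ _ [n [c [g [Sg ->]]]] [m [d [k [Sk ->]]]].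
exists (n + m)%N, (fun i => match split i with inl j => r * c j | inr j => d j end),
  (fun i => match split i with inl j => g j | inr j => k j end); split.
  by move=> i; case: split.
rewrite big_split_ord mulr_sumr /=; congr (_ + _); apply: eq_bigr => i _.
  by rewrite (unsplitK (inl i)) mulrA.
by rewrite (unsplitK (inr i)).
Qed.

Lemma ideal_gen_mem (T : comNzRingType) (S : set T) x : S x -> ideal_gen S x.
Proof.
move=> Sx; exists 1%N, (fun=> 1), (fun=> x); split=> //.
by rewrite big_ord1 mul1r.
Qed.

Lemma ideal_mul_mem (T : comNzRingType) (A B : set T) a b :
  A a -> B b -> ideal_mul A B (a * b).
Proof. by move=> Aa Bb; apply: ideal_gen_mem; exists a, b. Qed.

(** * Complete intersections from a free summand of the conormal module *)

Section LocalCore.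
Variables (T : comNzRingType) (noeT : fg_ideals T) (locT : local_ring T).
Variables (I : set T) (n b c : nat).
Variables (f : 'cV[T]_n) (D2 : 'M[T]_(b, n)) (D3 : 'M[T]_(c, b)).
Hypotheses (Hf : generates f I) (exD2 : exact_mx D2 f) (exD3 : exact_mx D3 D2).
Hypothesis projD3 : projective_rowspan D3.
Hypothesis Ijac : I `<=` @jacobson T.

(* [T/I] is self-injective, phrased in [T]. *)
Definition self_injective_mod : Prop := forall b a (D : 'M[T]_(b, a)) (z : 'cV_b),
  (forall v : 'rV_b, (forall j, I ((v *m D) 0 j)) -> I ((v *m z) 0 0)) ->
  exists y : 'cV_a, forall j, I ((z - D *m y) j 0).

Variable s : T.
Hypotheses (injI : self_injective_mod) (nIs : ~ I s).
Hypothesis socI : forall c, jacobson c -> I (c * s).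
Hypothesis simple : forall r, ~ I r -> exists c, I (s - c * r).

Variable l : 'I_n.
Hypothesis faithful : ~ ideal_mul I I (s * f l 0).

Let HI : is_ideal I := generates_ideal Hf.

Lemma square_sub r : ideal_mul I I r -> I r.
Proof.
move=> [m [d [g [Hg ->]]]]; apply: ideal_sum => // i; apply: ideal_mull => //.
by have [x [y [Ix Iy ->]]] := Hg i; apply: ideal_mull.
Qed.

Lemma mulmx_ideal m k (v : 'rV[T]_m) (A : 'M[T]_(m, k)) j :
  (forall i, I (v 0 i)) \/ (forall i, I (A i j)) -> I ((v *m A) 0 j).
Proof.
rewrite mxE => -[H|H]; apply: ideal_sum => // i.
  exact: ideal_mulr.
exact: ideal_mull.
Qed.

(* [f l] generates a free summand of [I/I^2], split off by [y]. *)
Lemma free_summand : exists y : 'cV[T]_n,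
  (forall v : 'rV_n, ideal_mul I I ((v *m f) 0 0) -> I ((v *m y) 0 0)) /\
  I (1 - y l 0).
Proof.
have HI2 : is_ideal (ideal_mul I I) by apply: ideal_gen_ideal.
(* The class of [f l] has annihilator [I]: by [simple], an [r] outside [I] annihilating it would
   make [s] annihilate it too. *)
have torsion r : ideal_mul I I (r * f l 0) -> I r.
  move=> Hr; apply: contrapT => /simple[d Hd]; apply: faithful.
  have -> : s * f l 0 = (s - d * r) * f l 0 + d * (r * f l 0) by ring.
  apply: ideal_add => //; last exact: ideal_mull.
  by apply: ideal_mul_mem => //; apply: generates_mem Hf.
have [|k [N HN]] := fg_submod noeT (K := [set v : 'rV_n | ideal_mul I I ((v *m f) 0 0)]).
  split; first by rewrite /= mul0mx mxE; case: HI2.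
  move=> d u v Hu Hv; rewrite /= mulmxDl -scalemxAl mxE [X in X + _]mxE.
  by case: HI2 => _; apply.
(* [N] spans the relations of the conormal module; the unknown [y] is a functional on it with values
   in T/I and value 1 at [f l]. *)
have [|y Hy] := @injI _ _ (col_mx N (delta_mx 0 l)) (col_mx 0 1%:M).
  move=> v; rewrite -[v]hsubmxK !mul_row_col mulmx0 add0r mulmx1.
  set v1 := lsubmx v; set v2 := rsubmx v => H; apply: torsion.
  have /HN H1 : rowspan N (v1 *m N) by exists v1.
  have -> : v2 0 0 * f l 0 =
      ((v1 *m N + v2 *m delta_mx 0 l) *m f) 0 0 - (v1 *m N *m f) 0 0.
    rewrite mulmxDl [X in X - _]mxE addrAC subrr add0r -mulmxA -rowE [RHS]mxE big_ord1.
    by rewrite [row _ _ _ _]mxE.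
  apply: ideal_sub => //.
  rewrite mxE; apply: ideal_sum => // i.
  by apply: ideal_mul_mem; [exact: H | exact: generates_mem Hf].
exists y; split=> [v /HN[w ->]|]; last first.
  have := Hy (rshift k 0); rewrite mul_col_mx mxE col_mxEd [X in _ + X]mxE col_mxEd.
  by rewrite -rowE mxE [X in _ - X]mxE.
rewrite -mulmxA; apply: mulmx_ideal; right=> i.
have := Hy (lshift 1 i); rewrite mul_col_mx mxE col_mxEu [X in _ + X]mxE col_mxEu mxE add0r.
by move/(ideal_opp HI); rewrite opprK.
Qed.

Variables a1 a2 a3 : T.
Hypotheses (Ia1 : I a1) (Ia2 : I a2) (Ia3 : I a3).
Hypotheses (reg1 : regular_mod [set 0] a1) (reg2 : regular_mod (adjoin [set 0] a1) a2).
Hypothesis reg3 : regular_mod (adjoin (adjoin [set 0] a1) a2) a3.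

Lemma regular_perturb_mod (J : set T) (x a : T) : is_ideal J -> ~ J 1 ->
  jacobson a -> regular_mod J a -> exists i, regular_mod J (x + a ^+ i.+2).
Proof.
move=> HJ nJ1 ja rega.
have [S [h [h_surj h_ker]]] := ex_quotient_ring HJ nJ1.
have regh r : regular_mod J r <-> regular_mod [set 0] (h r).
  by rewrite -(regular_mod_preim h_surj) (preim_zero h_ker).
have [i] := regular_perturb (fg_ideals_surj h_surj noeT) (h x)
  (jacobson_surj h_surj ja) (proj1 (regh a) rega).
by rewrite -rmorphXn -rmorphD => /regh; exists i.
Qed.

Lemma adjoin2C (x y : T) :
  adjoin (adjoin [set 0] x) y = adjoin (adjoin [set 0] y) x.
Proof.
by apply/seteqP; split=> r /adjoin2P[u [v ->]]; apply/adjoin2P; exists v, u; rewrite addrC.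
Qed.

Lemma nI1 : ~ I 1.
Proof. by move/Ijac/jacobson_ninv; apply; exists 1; rewrite mulr1. Qed.

Lemma adjoin_subI J x : J `<=` I -> I x -> adjoin J x `<=` I.
Proof.
move=> JI Ix _ [j [d [/JI Ij ->]]].
by apply: ideal_add => //; apply: ideal_mull.
Qed.

(** The perturbation is made modulo (a1, a2), where [a3] is regular; two swaps then bring the new
    element to the front, so that [a1], [a2] stay a regular sequence modulo it. *)
Lemma regular_summand (x0 : T) : exists w, [/\ ideal_mul I I w,
   regular_mod [set 0] (x0 + w) ,
   regular_mod (adjoin [set 0] (x0 + w)) a1 &
   regular_mod (adjoin (adjoin [set 0] (x0 + w)) a1) a2].
Proof.
have I0 := zero_ideal T.
have sub0 : [set 0] `<=` I by move=> _ ->; case: HI.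
have [||i regx] := @regular_perturb_mod (adjoin (adjoin [set 0] a1) a2) x0 a3 _ _ (Ijac Ia3) reg3.
- by apply/adjoin_ideal/adjoin_ideal.
- by move/(adjoin_subI (adjoin_subI sub0 Ia1) Ia2)/nI1.
(* An exponent of at least two puts the correction in the square of [I], so the class of [x0] in the
   conormal module is unchanged. *)
exists (a3 ^+ i.+2); set x := x0 + _ in regx *.
have [regx' reg2'] := regular_mod_swap noeT (adjoin_ideal a1 I0) (Ijac Ia2) reg2 regx.
have [regx'' reg1'] := regular_mod_swap noeT I0 (Ijac Ia1) reg1 regx'.
split=> //; last by rewrite adjoin2C.
by rewrite exprS; apply: ideal_mul_mem => //; rewrite exprS; apply: ideal_mulr.
Qed.

Lemma regular_row (x : T) k (v : 'rV[T]_k) : regular_mod [set 0] x -> x *: v = 0 -> v = 0.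
Proof.
by move=> regx /rowP e; apply/rowP => i; rewrite mxE; apply: regx; have := e i; rewrite !mxE.
Qed.

Lemma local_complete_intersection : exists x y z : T,
  [/\ forall r, I r <-> exists p q r', r = p * x + q * y + r' * z,
      regular_mod [set 0] x, regular_mod (adjoin [set 0] x) y
    & regular_mod (adjoin (adjoin [set 0] x) y) z].
Proof.
have [y [y2 yl]] := free_summand.
have [w [I2w regx rega1 rega2]] := regular_summand (f l 0).
set x := f l 0 + w in regx rega1 rega2.
have Iw := square_sub I2w.
have Ix : I x by apply: ideal_add => //; apply: generates_mem Hf.
have /Hf[ew eew] := Iw.
(* [e] lists coordinates of [x] in the generators [f]. It gives the map from T/I to I/xI sending 1
   to x, and [y] gives its retraction. *)
pose e := delta_mx 0 l + ew.
have ef : e *m f = x%:M.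
  rewrite mulmxDl -eew -rowE raddfD /=; congr (_ + _).
  by apply/mx11E; rewrite mxE.
have ey : I (1 - (e *m y) 0 0).
  have -> : (e *m y) 0 0 = y l 0 + (ew *m y) 0 0.
    by rewrite mulmxDl -rowE mxE [X in X + _]mxE.
  rewrite opprD addrA; apply: ideal_sub => //.
  by apply: y2; rewrite -eew mxE eqxx.
have n1 : ~ adjoin [set 0] x 1.
  by move/(adjoin_subI _ Ix) => H; apply/nI1/H => _ ->; case: HI.
have [S [h [h_surj h_ker]]] := ex_quotient_ring (adjoin_ideal x (zero_ideal T)) n1.
have hx0 : h x = 0 by apply/h_ker/adjoin_mem/zero_ideal.
have noeS := fg_ideals_surj h_surj noeT.
have locS := local_ring_surj h_surj locT.
have lift_row k (v : 'rV[S]_k) : exists v', map_mx h v' = v.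
  have /(_ _)/cid F i := h_surj (v 0 i); exists (\row_i sval (F i)).
  by apply/rowP => i; rewrite !mxE; case: (F i).
have ker_row k (v : 'rV[T]_k) : map_mx h v = 0 -> exists v', v = x *: v'.
  move=> /rowP v0; have /(_ _)/cid F i : exists d, v 0 i = d * x.
    by apply/adjoin0P/h_ker; have := v0 i; rewrite !mxE.
  exists (\row_i sval (F i)); apply/rowP => i.
  by apply: etrans (proj2_sig (F i)) _; rewrite !mxE mulrC.
have hI r : (h @` I) (h r) <-> I r.
  split=> [[r' Ir' /eqP]|Ir]; last by exists r.
  rewrite -subr_eq0 -rmorphB => /eqP/h_ker/adjoin0P[d ed].
  have -> : r = r' - d * x by rewrite -ed; ring.
  by apply: ideal_sub => //; apply: ideal_mull.
(* Exactness survives reduction modulo [x]: if [v' *m D2] is [x *: u], regularity of [x] makes [u] a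
   relation of [f], and [v'] can be corrected by a multiple of [x]. So [D2] modulo [x] presents
   I/xI. *)
have exS : exact_mx (map_mx h D3) (map_mx h D2).
  move=> v; split=> [|[u ->]]; last first.
    by rewrite -mulmxA -map_mxM (exact_mx0 exD3) map_mx0 mulmx0.
  have [v' <-] := lift_row _ v; rewrite -map_mxM => /ker_row[u eu].
  have /exD2[u' eu'] : u *m f = 0.
    apply: (regular_row regx); rewrite scalemxAl -eu -mulmxA (exact_mx0 exD2).
    exact: mulmx0.
  have /exD3[r er] : (v' - x *: u') *m D2 = 0.
    by rewrite mulmxBl eu -scalemxAl eu' subrr.
  exists (map_mx h r); rewrite -map_mxM -er map_mxB map_mxZ hx0 scale0r subr0 //.
have projS : projective_rowspan (map_mx h D3).
  have [P [PD Pker]] := projD3; exists (map_mx h P); split.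
    by rewrite -map_mxM PD.
  move=> v; have [v' <-] := lift_row _ v; rewrite -!map_mxM => /ker_row[u eu].
  have /exD3[u' eu'] : u *m D2 = 0.
    apply: (regular_row regx); rewrite scalemxAl -eu -mulmxA (exact_mx0 exD3).
    exact: mulmx0.
  have /Pker/eqP : (v' - x *: u') *m D3 = 0.
    by rewrite mulmxBl eu -scalemxAl eu' subrr.
  rewrite mulmxBl subr_eq0 => /eqP ->.
  by rewrite -scalemxAl map_mxZ hx0 scale0r.
have [||||||||||y' [z' [genS regy regz]]] := @gorenstein_codim2_ci S noeS locS (h @` I)
    (h a1) (h a2) _ _ _ _ _ _ (map_mx h f) (h s).
- by move=> _ [r Ir <-]; apply: jacobson_surj => //; apply: Ijac.
- exact/hI.
- exact/hI.
- by rewrite -(regular_mod_preim h_surj) (preim_zero h_ker).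
- by rewrite -(regular_mod_preim h_surj) (preim_adjoin h_surj h_ker).
- exact: generates_image.
- move=> m g k G Hg exG.
  apply: (retract_projective (e := map_mx h e) (y := map_mx h y) Hg exG exS projS).
  (* Both [r *: e] and [x *: rho] are sent to [r * x] by [f], so they differ by a relation: the map
     sending 1 to x is well defined on T/I. *)
  + move=> _ [r /Hf[rho er] <-].
    have /exD2[u eu] : (r *: e - x *: rho) *m f = 0.
      by rewrite mulmxBl -!scalemxAl ef -er !scale_scalar_mx mulrC subrr.
    exists (map_mx h u); rewrite -map_mxM -eu map_mxB !map_mxZ hx0 scale0r.
    by rewrite subr0.
  + move=> i; rewrite -map_mxM mxE; apply/hI.
    have -> : (D2 *m y) i 0 = (row i D2 *m y) 0 0 by rewrite -row_mul [RHS]mxE.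
    apply: y2; rewrite -row_mul (exact_mx0 exD2) !mxE.
    by case: (ideal_gen_ideal [set x | exists a b, [/\ I a, I b & x = a * b]]).
  + by rewrite -map_mxM [map_mx _ _ _ _]mxE -(rmorph1 h) -rmorphB; apply/hI.
- by move/hI.
- move=> d' jd'; have [d ed] := h_surj d'; rewrite -ed -rmorphM; apply/hI/socI.
  by apply: (jacobson_lift (h := h) locT); rewrite ed.
- move=> r'; have [r <-] := h_surj r' => nIr.
  have [|d Hd] := simple (r := r); first by move/hI.
  by exists (h d); rewrite -rmorphM -rmorphB; apply/hI.
have [yy eyy] := h_surj y'; have [zz ezz] := h_surj z'.
subst y' z'; exists x, yy, zz; split=> //; last 2 first.
- by move: regy; rewrite -(regular_mod_preim h_surj) (preim_zero h_ker).
- by move: regz; rewrite -(regular_mod_preim h_surj) (preim_adjoin h_surj h_ker).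
move=> r; split.
  move/hI/genS => [p' [q' epq]]; have [p ep] := h_surj p'; have [q eq] := h_surj q'.
  have /h_ker/adjoin0P[d ed] : h (r - (p * yy + q * zz)) = 0.
    by rewrite rmorphB rmorphD !rmorphM ep eq -epq subrr.
  by exists d, p, q; rewrite -addrA -ed subrK.
have Iyy : I yy by apply/hI/genS; exists 1, 0; rewrite mul1r mul0r addr0.
have Izz : I zz by apply/hI/genS; exists 0, 1; rewrite mul1r mul0r add0r.
move=> [p [q [d ->]]].
by apply: ideal_add => //; [apply: ideal_add => //|]; apply: ideal_mull.
Qed.

End LocalCore.

(** * Localization *)

Section LocalizationMap.
Variables (R : comNzRingType) (W : set R).
Hypotheses (W1 : W 1) (WM : forall u v, W u -> W v -> W (u * v)).
Variables (T : comNzRingType) (h : {rmorphism R -> T}).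
Hypothesis h_inv : forall u, W u -> invertible (h u).
Hypothesis h_frac : forall t, exists r u, W u /\ t * h u = h r.

(** The results stated before [h_ker] leave the kernel of [h] open, so they also apply to the map
    from R to a localization of R/I. *)
Lemma mul_inv_inj (t t' : T) u : W u -> t * h u = t' * h u -> t = t'.
Proof.
move=> /h_inv[v uv] e; rewrite -[t]mulr1 -[t']mulr1 -uv !mulrA.
by rewrite e.
Qed.

Lemma W_prod (I : finType) (F : I -> R) (P : pred I) :
  (forall i, W (F i)) -> W (\prod_(i | P i) F i).
Proof. by move=> WF; elim/big_ind: _ => // i _; apply: WF. Qed.

Lemma fg_ideals_frac : fg_ideals R -> fg_ideals T.
Proof.
apply: (fg_ideals_image (h := h)) => t; have [r [u [Wu e]]] := h_frac t.
have [v uv] := h_inv Wu; exists r, (h u), v; split=> //.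
by rewrite -e -mulrA uv mulr1.
Qed.

Definition frac_ideal (J : set R) : set T :=
  [set t | exists u r, [/\ W u, J r & t * h u = h r]].

Lemma frac_ideal_ideal J : is_ideal J -> is_ideal (frac_ideal J).
Proof.
move=> HJ; split; first by exists 1, 0; rewrite rmorph0 mul0r; split=> //; case: HJ.
move=> c a b [u [r [Wu Jr e]]] [v [s [Wv Js e']]].
have [d [w [Ww e'']]] := h_frac c.
exists (u * v * w), (d * (r * v) + s * u * w); split.
- by apply: WM => //; apply: WM.
- apply: ideal_add => //; first by apply: ideal_mull => //; apply: ideal_mulr.
  by rewrite -mulrA; apply: ideal_mulr.
- by rewrite rmorphD !rmorphM -e -e' -e''; ring.
Qed.

Lemma frac_ideal_mem J r : J r -> frac_ideal J (h r).
Proof. by move=> Jr; exists 1, r; rewrite rmorph1 mulr1. Qed.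

Lemma frac_ideal_min J (K : set T) : is_ideal K -> (forall r, J r -> K (h r)) ->
  frac_ideal J `<=` K.
Proof.
move=> HK JK t [u [r [/h_inv[v uv] /JK Kr e]]].
have -> : t = v * h r by rewrite -e mulrCA [v * _]mulrC uv mulr1.
exact: ideal_mull.
Qed.

Lemma frac_ideal_gen J : is_ideal J -> ideal_gen (h @` J) = frac_ideal J.
Proof.
move=> HJ; apply/seteqP; split.
  move=> _ [n [c [g [Hg ->]]]]; apply: ideal_sum; first exact: frac_ideal_ideal.
  move=> i; apply: ideal_mull; first exact: frac_ideal_ideal.
  by have [r Jr <-] := Hg i; apply: frac_ideal_mem.
apply: frac_ideal_min; first exact: ideal_gen_ideal.
by move=> r Jr; apply: ideal_gen_mem; exists r.
Qed.

Lemma frac_ideal_mul I J : is_ideal I -> is_ideal J ->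
  ideal_mul (frac_ideal I) (frac_ideal J) `<=` frac_ideal (ideal_mul I J).
Proof.
move=> HI HJ _ [n [c [g [Hg ->]]]].
have HIJ : is_ideal (frac_ideal (ideal_mul I J)) by apply/frac_ideal_ideal/ideal_gen_ideal.
apply: ideal_sum => // i; apply: ideal_mull => //.
have [x [y [[u [r [Wu Ir e]]] [v [s [Wv Js e']]] ->]]] := Hg i.
exists (u * v), (r * s); split; [exact: WM | exact: ideal_mul_mem |].
by rewrite !rmorphM -e -e'; ring.
Qed.

Lemma common_denominator k (v : 'rV[T]_k) : exists u (v' : 'rV[R]_k),
  W u /\ h u *: v = map_mx h v'.
Proof.
have /(_ _)/cid F i : exists p, W p.2 /\ v 0 i * h p.2 = h p.1.
  by have [r [u H]] := h_frac (v 0 i); exists (r, u).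
pose r i := (sval (F i)).1; pose u i := (sval (F i)).2.
exists (\prod_i u i), (\row_i (r i * \prod_(j | j != i) u j)); split.
  by apply: W_prod => i; case: (proj2_sig (F i)).
apply/rowP => i; rewrite !mxE (bigD1 i) //= !rmorphM.
have [_ <-] := proj2_sig (F i); rewrite -/(u i); ring.
Qed.

Hypothesis h_ker : forall r, h r = 0 -> exists2 u, W u & u * r = 0.

Lemma frac_eq r r' : h r = h r' -> exists2 u, W u & u * r = u * r'.
Proof.
move=> e; have [|u Wu eu] := h_ker (r := r - r'); first by rewrite rmorphB e subrr.
by exists u => //; apply/eqP; rewrite -subr_eq0 -mulrBr eu.
Qed.

Lemma row_ker k (v : 'rV[R]_k) : map_mx h v = 0 -> exists2 u, W u & u *: v = 0.
Proof.
move=> /rowP e; have /(_ _)/cid F i : exists u, W u /\ u * v 0 i = 0.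
  by have [|u Wu eu] := h_ker (r := v 0 i); [have := e i; rewrite !mxE | exists u].
exists (\prod_i sval (F i)); first by apply: W_prod => i; case: (proj2_sig (F i)).
apply/rowP => i; rewrite !mxE (bigD1 i) //= mulrAC.
by have [_ ->] := proj2_sig (F i); rewrite mul0r.
Qed.

(** Flatness of localization: a common denominator moves [v] to R, and a second one makes its
    product with [B] vanish there. *)
Lemma exact_mx_frac c b a (A : 'M[R]_(c, b)) (B : 'M_(b, a)) :
  exact_mx A B -> exact_mx (map_mx h A) (map_mx h B).
Proof.
move=> ex v; split=> [|[w ->]]; last first.
  by rewrite -mulmxA -map_mxM (exact_mx0 ex) map_mx0 mulmx0.
have [u [v' [Wu e]]] := common_denominator v => vB.
have [|u' Wu' e'] := row_ker (v := v' *m B).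
  by rewrite map_mxM -e -scalemxAl vB scaler0.
have /ex[w ew] : (u' *: v') *m B = 0 by rewrite -scalemxAl.
have [d ud] := h_inv (WM Wu' Wu).
exists (d *: map_mx h w); rewrite -scalemxAl -map_mxM -ew map_mxZ -e !scalerA.
by rewrite -mulrA -rmorphM mulrC ud scale1r.
Qed.

(** On generating syzygies [N] the kernel condition becomes the identity [N *m P = 0], which
    localizes. *)
Lemma projective_frac c b (A : 'M[R]_(c, b)) : fg_ideals R ->
  projective_rowspan A -> projective_rowspan (map_mx h A).
Proof.
move=> noeR [P [PA Pker]]; have [k [N exN]] := ex_syzygies noeR A.
exists (map_mx h P); split; first by rewrite -map_mxM PA.
move=> v /(exact_mx_frac exN)[w ->]; rewrite -mulmxA -map_mxM.
have -> : N *m P = 0.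
  by apply/row_matrixP => i; rewrite row_mul row0 Pker // -row_mul (exact_mx0 exN) row0.
by rewrite map_mx0 mulmx0.
Qed.

Lemma generates_frac n (f : 'cV[R]_n) J : generates f J ->
  generates (map_mx h f) (frac_ideal J).
Proof.
move=> Hf; have HJ := generates_ideal Hf.
have HS : is_ideal [set t | rowspan (map_mx h f) t%:M].
  exact: (generates_ideal (f := map_mx h f)).
move=> t; split=> [|[w /esym/mx11E <-]].
  apply: (frac_ideal_min (K := [set t | rowspan (map_mx h f) t%:M])) => // r /Hf[w ew].
  by exists (map_mx h w); rewrite -map_mxM -ew map_scalar_mx.
rewrite mxE; apply: ideal_sum; first exact: frac_ideal_ideal.
move=> i; apply: ideal_mull; first exact: frac_ideal_ideal.
by rewrite mxE; apply/frac_ideal_mem/(generates_mem i Hf).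
Qed.

Lemma frac_idealP J r : is_ideal J -> frac_ideal J (h r) -> exists2 u, W u & J (u * r).
Proof.
move=> HJ [u [s [Wu Js]]]; rewrite -rmorphM => /frac_eq[v Wv e].
exists (v * u); first exact: WM.
by rewrite -mulrA [u * r]mulrC e; apply: ideal_mull.
Qed.

Lemma regular_mod_frac J a : is_ideal J -> regular_mod J a ->
  regular_mod (frac_ideal J) (h a).
Proof.
move=> HJ rega t; have [r [w [Ww e]]] := h_frac t => Jt.
have /frac_idealP : frac_ideal J (h (a * r)).
  by rewrite rmorphM -e mulrA; apply: ideal_mulr => //; apply: frac_ideal_ideal.
move=> /(_ HJ)[u Wu]; rewrite mulrCA => /rega Ju.
exists (u * w), (u * r); split=> //; first exact: WM.
by rewrite !rmorphM -e; ring.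
Qed.

Lemma frac_ideal0 : frac_ideal [set 0] = [set 0].
Proof.
apply/seteqP; split=> [t [u [_ [Wu ->]]]|_ ->].
  by rewrite rmorph0 => e; apply: (mul_inv_inj Wu); rewrite mul0r.
by rewrite -(rmorph0 h); apply: frac_ideal_mem.
Qed.

Lemma frac_ideal_adjoin J a : is_ideal J ->
  frac_ideal (adjoin J a) = adjoin (frac_ideal J) (h a).
Proof.
move=> HJ; have HF := frac_ideal_ideal HJ; apply/seteqP; split.
  apply: frac_ideal_min; first exact: adjoin_ideal.
  move=> _ [j [c [Jj ->]]]; exists (h j), (h c); rewrite rmorphD rmorphM; split=> //.
  exact: frac_ideal_mem.
have HA := frac_ideal_ideal (adjoin_ideal a HJ).
move=> _ [j [c [[u [r [Wu Jr e]]] ->]]]; apply: ideal_add => //.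
  by exists u, r; split=> //; apply: adjoin_sub.
by apply: ideal_mull => //; apply/frac_ideal_mem/adjoin_mem.
Qed.

(** The universal property. The map is defined through its graph [rel], since fractions have no
    preferred representative. *)
Lemma frac_lift (S : comNzRingType) (g : {rmorphism R -> S}) :
  (forall u, W u -> invertible (g u)) ->
  exists k : {rmorphism T -> S}, forall r, k (h r) = g r.
Proof.
move=> g_inv.
pose rel t s := exists r u, [/\ W u, t * h u = h r & s * g u = g r].
have rel_ex t : exists s, rel t s.
  have [r [u [Wu e]]] := h_frac t; have [v uv] := g_inv u Wu.
  by exists (g r * v), r, u; split=> //; rewrite -mulrA [v * _]mulrC uv mulr1.
have g_inj u s s' : W u -> s * g u = s' * g u -> s = s'.
  move=> /g_inv[v uv] e; rewrite -[s]mulr1 -[s']mulr1 -uv !mulrA.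
  by rewrite e.
have rel_fun t s s' : rel t s -> rel t s' -> s = s'.
  move=> [r [u [Wu e1 e2]]] [r' [u' [Wu' e1' e2']]].
  have /frac_eq[v Wv ev] : h (r * u') = h (r' * u).
    by rewrite !rmorphM -e1 -e1'; ring.
  apply: (g_inj (v * (u * u'))); first by do 2?apply: WM.
  have /(congr1 g) := ev; rewrite !rmorphM -e2 -e2' => e3.
  transitivity (g v * (s * g u * g u')); first by ring.
  by rewrite e3; ring.
pose k t := sval (cid (rel_ex t)).
have kP t s : rel t s -> k t = s by apply: rel_fun; rewrite /k; case: (cid _).
have kE t : rel t (k t) by rewrite /k; case: (cid _).
have k_add : zmod_morphism k.
  move=> t t'; apply: kP.
  have [r [u [Wu e1 e2]]] := kE t; have [r' [u' [Wu' e1' e2']]] := kE t'.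
  exists (r * u' - r' * u), (u * u'); split; first exact: WM.
    by rewrite rmorphB !rmorphM -e1 -e1'; ring.
  by rewrite rmorphB !rmorphM -e2 -e2'; ring.
have k_mul : monoid_morphism k.
  split; first by apply: kP; exists 1, 1; rewrite !rmorph1 !mulr1.
  move=> t t'; apply: kP.
  have [r [u [Wu e1 e2]]] := kE t; have [r' [u' [Wu' e1' e2']]] := kE t'.
  exists (r * r'), (u * u'); split; first exact: WM.
    by rewrite !rmorphM -e1 -e1'; ring.
  by rewrite !rmorphM -e2 -e2'; ring.
pose kz := GRing.isZmodMorphism.Build T S k k_add.
pose km := GRing.isMonoidMorphism.Build T S k k_mul.
pose kk : {rmorphism T -> S} := HB.pack k kz km.
by exists kk => r; apply: kP; exists r, 1; rewrite !rmorph1 !mulr1.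
Qed.

End LocalizationMap.

Lemma ex_idealr (R : comNzRingType) (J : set R) : is_ideal J -> ~ J 1 ->
  exists I : idealr R, [set` I] = J.
Proof.
move=> HJ nJ1.
pose p : R -> bool := fun r => `[< J r >].
have p_closed : idealr_closed p.
  split; first by apply/asboolP; case: HJ.
    by apply/asboolP.
  by move=> c a b /asboolP Ja /asboolP Jb; apply/asboolP; case: HJ => _; apply.
pose pI := isIdealr.Build R p p_closed.
pose I : idealr R := HB.pack p pI.
by exists I; apply/seteqP; split=> r /= /asboolP.
Qed.

Lemma ex_prime_idealr (R : comNzRingType) (q : set R) : is_prime q ->
  exists p : prime_idealr R, [set` p] = q.
Proof.
move=> [Hq nq1 qM].
pose p : R -> bool := fun r => `[< q r >].
have p_closed : idealr_closed p.
  split; first by apply/asboolP; case: Hq.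
    by apply/asboolP.
  by move=> c a b /asboolP Ja /asboolP Jb; apply/asboolP; case: Hq => _; apply.
have p_prime : prime_idealr_closed p.
  by move=> u v /asboolP/qM[] H; apply/orP; [left|right]; apply/asboolP.
pose pI := isIdealr.Build R p p_closed.
pose pP := isPrimeIdealrClosed.Build R p p_prime.
pose P : prime_idealr R := HB.pack p pI pP.
by exists P; apply/seteqP; split=> r /= /asboolP.
Qed.

Lemma idealr_is_ideal (R : comNzRingType) (I : idealr R) : is_ideal [set` I].
Proof.
split; first exact: idealr0.
by move=> c a b /= Ia Ib; rewrite rpredD // idealMr.
Qed.

Lemma prime_idealr_is_prime (R : comNzRingType) (p : prime_idealr R) : is_prime [set` p].
Proof.
split; first exact: idealr_is_ideal.
  by rewrite /= idealr1.
by move=> a b /=; rewrite prime_idealrM => /orP.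
Qed.

Lemma ideal_gen_nil (R : comNzRingType) : ideal_gen [set` [::] : seq R] = [set 0].
Proof.
apply/seteqP; split=> [_ [[|n] [c [g [Hg ->]]]]|_ ->].
- by rewrite big_ord0.
- by have := Hg ord0.
- by case: (ideal_gen_ideal [set` [::] : seq R]).
Qed.

Lemma ideal_gen_min (R : comNzRingType) (S J : set R) :
  is_ideal J -> S `<=` J -> ideal_gen S `<=` J.
Proof.
move=> HJ SJ _ [n [c [g [Hg ->]]]]; apply: ideal_sum => // i.
by apply: ideal_mull => //; apply: SJ.
Qed.

Lemma ideal_gen_rcons (R : comNzRingType) (s : seq R) a :
  ideal_gen [set` rcons s a] = adjoin (ideal_gen [set` s]) a.
Proof.
have Hs := ideal_gen_ideal [set` s]; apply/seteqP; split.
  apply: ideal_gen_min; first exact: adjoin_ideal.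
  move=> x; rewrite /= mem_rcons inE => /orP[/eqP ->|xs]; first exact: adjoin_mem.
  by apply: adjoin_sub; apply: ideal_gen_mem.
have Ha := ideal_gen_ideal [set` rcons s a].
move=> _ [j [c [Hj ->]]]; apply: ideal_add => //; last first.
  by apply: ideal_mull => //; apply: ideal_gen_mem; rewrite /= mem_rcons mem_head.
apply: (ideal_gen_min Ha) Hj => x xs; apply: ideal_gen_mem.
by rewrite /= mem_rcons inE; apply/orP; right.
Qed.

Lemma ideal_gen_fg (R : comNzRingType) (s : seq R) :
  exists n (f : 'cV[R]_n), generates f (ideal_gen [set` s]).
Proof.
elim/last_ind: s => [|s a [n [f Hf]]].
  exists 0%N, 0; rewrite ideal_gen_nil => r; split=> [->|[w]].
    by exists 0; rewrite mulmx0 raddf0.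
  by rewrite mulmx0 => /matrixP/(_ 0 0); rewrite !mxE eqxx.
exists (n + 1)%N, (col_mx f a%:M); rewrite ideal_gen_rcons => r; split.
  move=> [j [c [/Hf[w ew] ->]]]; exists (row_mx w c%:M).
  by rewrite mul_row_col -ew -scalar_mxM raddfD.
move=> [w]; rewrite -[w]hsubmxK mul_row_col => e.
exists ((lsubmx w *m f) 0 0), (rsubmx w 0 0); split.
  by apply/Hf; exists (lsubmx w); symmetry; apply/mx11E.
move/matrixP/(_ 0 0): e; rewrite mxE eqxx mulr1n => ->.
by rewrite mxE [X in _ + X]mxE big_ord1 [a%:M _ _]mxE eqxx.
Qed.

Lemma noetherian_fg_ideals (R : comNzRingType) : noetherian R -> fg_ideals R.
Proof.
move=> noeR J HJ; have [J1|nJ1] := pselect (J 1).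
  exists 1%N, 1%:M => r; split=> _; first by exists r%:M; rewrite mulmx1.
  by rewrite -[r]mulr1; apply: ideal_mull.
have [I <-] := ex_idealr HJ nJ1; have [s ->] := noeR I.
exact: ideal_gen_fg.
Qed.

(** * Localization at a prime ideal *)

Section LocalizationFacts.
Variables (R : comNzRingType) (p : prime_idealr R).

Definition outside : set R := [set u | u \notin p].

Lemma outside1 : outside 1.
Proof. exact: Localization.notin1. Qed.

Lemma outsideM u v : outside u -> outside v -> outside (u * v).
Proof. exact: Localization.notinM. Qed.

Lemma toloc_inv u : outside u -> invertible (toloc p u).
Proof.
move=> up; exists (\pi_(localization p) (Localization.mkfrac 1 up))%qT.
rewrite -[LHS]/(Localization.mul _ _) -Localization.pi_mul.
by apply: Localization.eq_pi1; rewrite /Localization.num /Localization.den /=; ring.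
Qed.

Lemma toloc_frac (t : localization p) : exists r u, outside u /\ t * toloc p u = toloc p r.
Proof.
elim/quotW: t => x; exists (Localization.num x), (Localization.den x).
split; first exact: Localization.den_notin.
rewrite -[LHS]/(Localization.mul _ _) -Localization.pi_mul.
by apply: Localization.eq_pi1; rewrite /Localization.mulf /Localization.mkfrac
  /Localization.num /Localization.den /=; ring.
Qed.

Lemma toloc_ker r : toloc p r = 0 -> exists2 u, outside u & u * r = 0.
Proof.
move=> /eqmodP/asboolP[u up]; rewrite /Localization.num /Localization.den /=.
by rewrite mulr1 mul0r subr0; exists u.
Qed.

Variables (T : comNzRingType) (h : {rmorphism R -> T}).
Hypothesis h_inv : forall u, outside u -> invertible (h u).
Hypothesis h_frac : forall t, exists r u, outside u /\ t * h u = h r.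

Lemma jacobson_frac r : r \in p -> jacobson (h r).
Proof.
move=> rp c; have [d [u [up e]]] := h_frac c.
have [|w ew] := h_inv (u := u - d * r).
  apply/negP => H; move/negP: up; apply.
  by rewrite -[u](subrK (d * r)) rpredD // idealMr.
by exists (h u * w); rewrite -[RHS]ew rmorphB rmorphM -e; ring.
Qed.

Lemma frac_jacobson r : jacobson (h r) -> r \in p.
Proof.
by move=> jr; apply: contrapT => /negP/h_inv; apply: jacobson_ninv.
Qed.

Lemma local_ring_frac : local_ring T.
Proof.
move=> t; have [r [u [up e]]] := h_frac t.
have [v uv] := h_inv up.
have -> : t = v * h r by rewrite -e mulrCA [v * _]mulrC uv mulr1.
have [rp|rp] := boolP (r \in p); last first.
  left; apply: invertibleM; last exact: h_inv.
  by exists (h u); rewrite mulrC.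
by right; apply: jacobsonM; apply: jacobson_frac.
Qed.

End LocalizationFacts.

Lemma ex_quotient_prime (R : comNzRingType) (I : idealr R) (p : prime_idealr R) :
  [set` I] `<=` [set` p] ->
  exists p' : prime_idealr {ideal_quot I}, forall r, (\pi r \in p')%qT = (r \in p).
Proof.
move=> Ip.
have Hp := prime_idealr_is_prime p.
pose q : set {ideal_quot I} := [set a | exists2 r, r \in p & (\pi r = a)%qT].
have qP r : q (\pi r)%qT <-> r \in p.
  split=> [[r' r'p /eqP]|rp]; last by exists r.
  rewrite -Quotient.idealrBE => /Ip /= H.
  by rewrite -[r](subKr r') rpredB.
have piS (a : {ideal_quot I}) : exists r, a = (\pi r)%qT.
  by exists (repr a); rewrite reprK.
have [|p' ep'] := @ex_prime_idealr _ q.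
  split.
  - split; first by rewrite -(rmorph0 (\pi_{ideal_quot I})%qT); apply/qP; apply: rpred0.
    move=> c a b; have [c' ->] := piS c; have [a' ->] := piS a; have [b' ->] := piS b.
    rewrite -rmorphM -rmorphD => /qP Ha /qP Hb; apply/qP.
    by rewrite rpredD // idealMr.
  - by rewrite -(rmorph1 (\pi_{ideal_quot I})%qT) => /qP; rewrite idealr1.
  - move=> a b; have [a' ->] := piS a; have [b' ->] := piS b.
    rewrite -rmorphM => /qP; rewrite prime_idealrM.
    by move=> /orP[] H; [left|right]; apply/qP.
exists p' => r.
have e : [set` p'] (\pi r)%qT <-> q (\pi r)%qT by rewrite ep'.
by apply/idP/idP => [/e/qP|/qP/e].
Qed.

(** * The colon ideal criterion *)

Lemma regular_seq_rcons (R : comNzRingType) (s : seq R) a :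
  regular_seq (rcons s a) -> regular_mod (ideal_gen [set` s]) a.
Proof.
move=> [reg _] y; have := reg (size s).
rewrite size_rcons nth_rcons ltnn eqxx -cats1 take_size_cat // => H.
exact: H.
Qed.

Lemma regular_seq3P (R : comNzRingType) (x y z : R) :
  regular_seq [:: x; y; z] <->
  [/\ regular_mod [set 0] x, regular_mod (adjoin [set 0] x) y,
      regular_mod (adjoin (adjoin [set 0] x) y) z
    & ~ adjoin (adjoin (adjoin [set 0] x) y) z 1].
Proof.
rewrite -ideal_gen_nil -!ideal_gen_rcons /=.
split=> [[reg n1]|[r1 r2 r3 n1]].
  by split=> // [t|t|t]; [exact: (reg 0%N)|exact: (reg 1%N)|exact: (reg 2%N)].
by split=> // -[|[|[|]]].
Qed.

Section Main.
Variables (R : comNzRingType) (I : idealr R).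
Hypotheses (noeR : fg_ideals R) (gorA : gorenstein {ideal_quot I}).

Let HI : is_ideal [set` I] := idealr_is_ideal I.

Section AtPrime.
Variables (p : prime_idealr R) (Ip : [set` I] `<=` [set` p]).

(** [S] is the localization of R/I at the image of [p], formed in this order because the Gorenstein
    hypothesis concerns localizations of the quotient ring. *)
Lemma ex_local_quotient : exists (S : comNzRingType) (psi : {rmorphism R -> S}),
  [/\ forall u, outside p u -> invertible (psi u),
      forall t, exists r u, outside p u /\ t * psi u = psi r,
      forall r, psi r = 0 <-> exists2 u, outside p u & I (u * r),
      fg_ideals S
    & exists n, injdim_le (S^o : lmodType S) n].
Proof.
have [p' ep'] := ex_quotient_prime Ip.
pose pi := (\pi_{ideal_quot I}%qT : {rmorphism R -> {ideal_quot I}}).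
have pi_surj a : exists r, pi r = a by exists (repr a); rewrite /= reprK.
have pi_out u : outside p' (pi u) <-> outside p u by rewrite /outside /= ep'.
have pi0 r : pi r = 0 <-> I r.
  rewrite -(rmorph0 pi); split=> [/eqP|Ir]; first by rewrite -Quotient.idealrBE subr0.
  by apply/eqP; rewrite -Quotient.idealrBE subr0.
have inv := @toloc_inv _ p'; have frac := @toloc_frac _ p'.
exists (localization p' : comNzRingType), (toloc p' \o pi : {rmorphism R -> localization p'}).
split.
- by move=> u up; apply: inv; apply/pi_out.
- move=> t; have [a [b [bp e]]] := frac t.
  have [r er] := pi_surj a; have [u eu] := pi_surj b.
  by exists r, u; rewrite /= er eu; split=> //; apply/pi_out; rewrite eu.
- move=> r; split=> [/toloc_ker[a ap']|[u up Iur]].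
    have [u eu] := pi_surj a; rewrite -eu in ap' *.
    by rewrite -rmorphM => /pi0; exists u => //; apply/pi_out.
  have /inv[v uv] : outside p' (pi u) by apply/pi_out.
  rewrite /= -[toloc p' _]mulr1 -uv mulrA -rmorphM -rmorphM mulrC.
  by rewrite [r * u]mulrC (_ : pi _ = 0) ?rmorph0 ?mulr0 //; apply/pi0.
- case: gorA => /noetherian_fg_ideals noeA _.
  exact: (fg_ideals_frac (h := toloc p') inv frac).
- by case: gorA => _ /(_ p').
Qed.

Lemma socle_jacobson (S : comNzRingType) (psi : {rmorphism R -> S}) (s : S) :
  (forall u, outside p u -> invertible (psi u)) ->
  (forall t, exists r u, outside p u /\ t * psi u = psi r) ->
  (forall r, r \in p -> psi r * s = 0) -> forall c, jacobson c -> c * s = 0.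
Proof.
move=> inv frac Hs c jc; have [r [u [up e]]] := frac c.
apply: (mul_inv_inj inv up); rewrite mul0r mulrAC e; apply: Hs.
by apply: (frac_jacobson inv); rewrite -e mulrC; apply: jacobsonM.
Qed.

(** The class of [y] is a nonzero socle element of the localized R/I, so that ring is self-injective
    and its maximal ideal is nil. *)
Lemma depth0_nilpotent y : (forall u, outside p u -> ~ I (u * y)) ->
  (forall r, r \in p -> I (r * y)) ->
  forall r, r \in p -> exists k u, outside p u /\ I (u * r ^+ k).
Proof.
move=> ny py r rp.
have [S [psi [inv frac ker noeS [n inj]]]] := ex_local_quotient.
have locS := local_ring_frac inv frac.
have s0 : psi y != 0.
  by apply/eqP => /ker[u up]; apply: ny.
have jacs := socle_jacobson inv frac (s := psi y).
have [|k] := self_injective_nilpotent noeS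
  (injdim_self_injective noeS locS s0 _ inj) (jacobson_frac inv frac rp).
  apply: jacs => r' r'p; rewrite -rmorphM; apply/ker; exists 1; first exact: outside1.
  by rewrite mul1r; apply: py.
by rewrite -rmorphXn => /ker[u up Iu]; exists k, u.
Qed.

End AtPrime.

Lemma generically_ci_colon x a : generically_ci I -> I a -> regular_mod [set 0] a ->
  ideal_colon (ideal_mul [set` I] [set` I]) [set` I] x -> I x.
Proof.
move=> ci Ia rega colx; apply: contrapT => nIx.
have [y [nIy prq]] := ex_assoc_prime noeR HI nIx.
have [p ep] := ex_prime_idealr prq.
have pE r : r \in p <-> I (r * (y * x)).
  have e : [set` p] r <-> colon1 [set` I] (y * x) r by rewrite ep.
  exact: e.
have Ip : [set` I] `<=` [set` p].
  by move=> r /= Ir; apply/pE; apply: (ideal_mulr _ HI).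
(* A prime between [I] and [p] contains, up to a factor outside [p], a power of every element of
   [p]. *)
have minp : minimal_prime I p.
  split=> // q Iq qp; apply/seteqP; split=> // r rp.
  have [||k [u [up Iu]]] := depth0_nilpotent Ip (y := y * x) _ _ rp.
  - by move=> u up /pE; apply/negP.
  - by move=> r' /pE.
  have := Iq _ Iu; rewrite /= prime_idealrM => /orP[uq|].
    by have := qp _ uq; rewrite /= (negPf up).
  elim: k {Iu} => [|k IHk]; first by rewrite expr0 idealr1.
  by rewrite exprS prime_idealrM => /orP[].
pose h := toloc p : {rmorphism R -> localization p}.
have inv := @toloc_inv _ p; have frac := @toloc_frac _ p; have ker := @toloc_ker _ p.
have W1 := outside1 p; have WM := @outsideM _ p.
have [s [regs]] := ci p minp; set L := localized_ideal I p => eL.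
have eLF : L = frac_ideal (outside p) h [set` I] by apply: frac_ideal_gen.
suff : L (h x).
  rewrite eLF => /(frac_idealP WM ker HI)[u up Iux].
  have /pE : I (u * (y * x)) by rewrite mulrCA; apply: (ideal_mull _ HI).
  by rewrite (negPf up).
have HL : is_ideal L by apply: ideal_gen_ideal.
case/lastP: s regs eL => [|s b] regs eL.
  (* An empty sequence would make [L] zero, but the regular element [a] of [I] survives
     localization. *)
  have : L (h a) by apply: ideal_gen_mem; exists a.
  rewrite eL ideal_gen_nil => /ker[u up ua].
  have u0 : u = 0 by apply: rega; rewrite /= mulrC.
  by move: up; rewrite /outside /= u0 rpred0.
have regb := regular_seq_rcons regs; rewrite ideal_gen_rcons in eL.
set J := ideal_gen _ in regb eL.
have HJ : is_ideal J by apply: ideal_gen_ideal.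
have JL : J `<=` L by rewrite eL; apply: adjoin_sub.
have HLL : is_ideal (ideal_mul L L) by apply: ideal_gen_ideal.
have xL t : L t -> ideal_mul L L (h x * t).
  suff sub : frac_ideal (outside p) h [set` I] `<=` [set t | ideal_mul L L (h x * t)].
    by move=> Lt; apply: sub; rewrite -eLF.
  apply: (frac_ideal_min inv).
    split; first by rewrite /= mulr0; case: HLL.
    by move=> c t1 t2 H1 H2; rewrite /= mulrDr mulrCA; case: HLL => _; apply.
  suff sub : ideal_mul [set` I] [set` I] `<=` [set r | ideal_mul L L (h r)].
    by move=> r /colx/sub; rewrite /= rmorphM.
  apply: ideal_gen_min.
    split; first by rewrite /= rmorph0; case: HLL.
    by move=> c r1 r2 H1 H2; rewrite /= rmorphD rmorphM; case: HLL => _; apply.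
  move=> _ [r1 [r2 [I1 I2 ->]]]; rewrite /= rmorphM.
  by apply: ideal_mul_mem; apply: ideal_gen_mem; [exists r1|exists r2].
have LLsub : ideal_mul L L `<=` [set t | exists l j, [/\ L l, J j & t = b * l + j]].
  apply: ideal_gen_min.
    split; first by exists 0, 0; rewrite mulr0 addr0; split=> //; [case: HL|case: HJ].
    move=> c _ _ [l1 [j1 [L1 J1 ->]]] [l2 [j2 [L2 J2 ->]]].
    exists (c * l1 + l2), (c * j1 + j2); split; last by ring.
      by case: HL => _; apply.
    by case: HJ => _; apply.
  move=> _ [l1 [l2 [L1 L2 ->]]]; move: L1; rewrite {1}eL => -[j [c [Jj ->]]].
  exists (c * l2), (j * l2); split; [exact: ideal_mull|exact: ideal_mulr|ring].
have /xL/LLsub[l [j [Ll Jj e]]] : L b by rewrite eL; apply: adjoin_mem.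
rewrite -[h x](subrK l); apply: ideal_add => //; apply/JL/regb.
by rewrite mulrBr mulrC e addrC addKr.
Qed.

Lemma quotient_syzygy_projective n b c (f : 'cV[R]_n) (D2 : 'M_(b, n)) (D3 : 'M_(c, b)) :
  generates f [set` I] -> exact_mx D2 f -> exact_mx D3 D2 ->
  projdim_le ({ideal_quot I} : lmodType R) 3 -> projective_rowspan D3.
Proof.
move=> Hf exD2 exD3.
pose q0 (v : 'rV[R]_1) : {ideal_quot I} := \pi_{ideal_quot I}%qT (v 0 0).
have q0_lin : linear q0.
  move=> r u v; rewrite /q0 !mxE rmorphD rmorphM; congr (_ + _).
pose ql := GRing.isLinear.Build R 'rV[R]_1 {ideal_quot I} _ q0 q0_lin.
pose q : {linear 'rV[R]_1 -> {ideal_quot I}} := HB.pack q0 ql.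
apply: (projdim3_projective (q := q)) exD2 exD3.
  by move=> m; exists (repr m)%:M; rewrite /= /q0 mxE eqxx mulr1n reprK.
move=> v; have -> : rowspan f v <-> [set` I] (v 0 0 : R).
  by rewrite [v]mx11_scalar [_%:M 0 0]mxE eqxx mulr1n; apply: iff_sym; apply: Hf.
rewrite /= /q0 -(rmorph0 (\pi_{ideal_quot I})%qT); split=> [/eqP|Iv].
  by rewrite -Quotient.idealrBE subr0.
by apply/eqP; rewrite -Quotient.idealrBE subr0.
Qed.

Lemma colon_generically_ci (a1 a2 a3 : R) :
  projdim_le ({ideal_quot I} : lmodType R) 3 ->
  I a1 -> I a2 -> I a3 -> regular_seq [:: a1; a2; a3] ->
  ideal_colon (ideal_mul [set` I] [set` I]) [set` I] = [set` I] -> generically_ci I.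
Proof.
move=> pd I1 I2 I3 /regular_seq3P[reg1 reg2 reg3 _] colon p [Ip minp].
have [S [psi [inv frac ker noeS [n inj]]]] := ex_local_quotient Ip.
have locS := local_ring_frac inv frac.
pose T := localization p : comNzRingType.
pose h := toloc p : {rmorphism R -> T}.
have hinv : forall u, outside p u -> invertible (h u) := @toloc_inv _ p.
have hfrac : forall t : T, exists r u, outside p u /\ t * h u = h r := @toloc_frac _ p.
have hker : forall r, h r = 0 -> exists2 u, outside p u & u * r = 0 := @toloc_ker _ p.
have W1 := outside1 p; have WM := @outsideM _ p.
have noeT := fg_ideals_frac hinv hfrac noeR.
have locT := local_ring_frac hinv hfrac.
pose L := frac_ideal (outside p) h [set` I].
have HL : is_ideal L by apply: frac_ideal_ideal.
have Ljac : L `<=` @jacobson T.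
  apply: (frac_ideal_min hinv (jacobson_ideal T)) => r /Ip.
  exact: jacobson_frac.
have nL1 : ~ L 1 by move/Ljac/jacobson_ninv; apply; exists 1; rewrite mulr1.
(* [k] exhibits the localized quotient [S] as T/L; through it the properties of [S] are restated in
   [T]. *)
have [k kE] := frac_lift W1 WM hfrac hker inv.
have k0 t : k t = 0 <-> L t.
  have [r [u [up e]]] := hfrac t.
  have e' : k t * psi u = psi r by rewrite -!kE -rmorphM e.
  split=> [kt0|Lt].
    have /ker[v vp Ivr] : psi r = 0 by rewrite -e' kt0 mul0r.
    exists (v * u), (v * r); split=> //; first exact: WM.
    by rewrite !rmorphM -e; ring.
  apply: (mul_inv_inj inv up); rewrite mul0r e'; apply/ker.
  apply: (frac_idealP WM hker HI); rewrite -e; exact: ideal_mulr.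
have k_surj s : exists t, k t = s.
  have [r [u [up e]]] := frac s; have [w uw] := hinv u up.
  exists (h r * w); apply: (mul_inv_inj inv up).
  by rewrite e -!kE -rmorphM -mulrA [w * _]mulrC uw mulr1.
have [s1 [s1_neq0 [Hq nq1 qM]]] := ex_assoc_prime noeS (zero_ideal S) (elimN eqP (oner_neq0 S)).
rewrite mulr1 in s1_neq0 Hq nq1 qM.
(* The preimage in R of an associated prime of [S] lies between [I] and [p], so minimality makes it
   [p]; hence [s1] is a socle element. *)
have ps1 r : r \in p -> psi r * s1 = 0.
  have [|q eq] := @ex_prime_idealr R [set r | psi r * s1 = 0].
    split.
    - split; first by rewrite /= rmorph0 mul0r.
      by move=> c a b /= Ha Hb; rewrite rmorphD rmorphM mulrDl -mulrA Ha Hb mulr0 addr0.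
    - by rewrite /= rmorph1 mul1r.
    - by move=> a b; rewrite /= rmorphM; apply: qM.
  have {minp} := minp q; rewrite eq => minp rp.
  suff : [set r | psi r * s1 = 0] r by [].
  rewrite minp // => [a Ia|a /= psia].
    rewrite /= (_ : psi a = 0) ?mul0r //; apply/ker.
    by exists 1 => //; rewrite mul1r.
  apply: contrapT => /negP/inv[v uv]; apply: s1_neq0.
  by rewrite /= -[s1]mul1r -uv mulrAC psia mul0r.
have s1_soc := socle_jacobson inv frac ps1.
have s1_neq0' : s1 != 0 by apply/eqP.
have selfS := injdim_self_injective noeS locS s1_neq0' s1_soc inj.
have [s es] := k_surj s1.
have nLs : ~ L s by move/k0; rewrite es.
have injL : self_injective_mod L.
  move=> b a D z compat.
  have [|y ey] := selfS _ _ (map_mx k D) (map_mx k z).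
    move=> v'; have [v ->] : exists v, v' = map_mx k v.
      have /(_ _)/cid F i := k_surj (v' 0 i); exists (\row_i sval (F i)).
      by apply/rowP => i; rewrite !mxE; case: (F i).
    rewrite -!map_mxM => /rowP vD; apply/rowP => i; rewrite ord1.
    rewrite [LHS]mxE [RHS]mxE; apply/k0/compat => j; apply/k0.
    transitivity (map_mx k (v *m D) 0 j); first by rewrite [RHS]mxE.
    by rewrite vD mxE.
  have [y' ey'] : exists y', y = map_mx k y'.
    have /(_ _)/cid F i := k_surj (y i 0); exists (\col_i sval (F i)).
    by apply/colP => i; rewrite !mxE; case: (F i).
  exists y' => j; apply/k0; transitivity (map_mx k (z - D *m y') j 0).
    by rewrite [RHS]mxE.
  by rewrite map_mxB ey map_mxM -ey' subrr mxE.
have socL c : jacobson c -> L (c * s).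
  by move=> jc; apply/k0; rewrite rmorphM es; apply/s1_soc/jacobson_surj.
have simple r : ~ L r -> exists c, L (s - c * r).
  move=> nLr; have kr0 : k r != 0 by apply/eqP => /k0.
  have [c ec] := self_injective_socle locS selfS s1_soc kr0.
  have [d ed] := k_surj c; exists d; apply/k0.
  by rewrite rmorphB rmorphM ed es -ec subrr.
have [n0 [f Hf]] := noeR HI.
have [b [D2 exD2]] := ex_syzygies noeR f.
have [c [D3 exD3]] := ex_syzygies noeR D2.
have projD3 := quotient_syzygy_projective Hf exD2 exD3 pd.
(* Otherwise [s], cleared of denominators, would multiply all of [I] into its square; the colon
   hypothesis would put it in [I], against [nLs]. *)
have [l faithful] : exists l, ~ ideal_mul L L (s * (map_mx h f) l 0).
  apply: contrapT => /forallNP H.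
  have [r [u [up e]]] := hfrac s.
  have /(_ _)/cid F l : exists v, outside p v /\ ideal_mul [set` I] [set` I] (v * (r * f l 0)).
    have /contrapT/(frac_ideal_mul W1 WM hfrac HI HI) Hl := H l.
    have HI2 : is_ideal (ideal_mul [set` I] [set` I]) by apply: ideal_gen_ideal.
    have [|v vp Iv] := frac_idealP WM hker HI2 (r := r * f l 0); last by exists v.
    rewrite rmorphM -e mulrAC; apply: ideal_mulr; first exact: frac_ideal_ideal.
    by move: Hl; rewrite mxE.
  pose v := \prod_l sval (F l).
  have vp : outside p v by apply: W_prod => // l; case: (proj2_sig (F l)).
  have : [set` I] (v * r).
    rewrite -colon => x /(generatesP Hf)[w ->].
    have HI2 : is_ideal (ideal_mul [set` I] [set` I]) by apply: ideal_gen_ideal.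
    rewrite mulr_sumr; apply: ideal_sum => // l.
    have -> : v * r * (w 0 l * f l 0) =
        w 0 l * \prod_(i | i != l) sval (F i) * (sval (F l) * (r * f l 0)).
      by rewrite /v (bigD1 l) //=; ring.
    by apply: ideal_mull => //; case: (proj2_sig (F l)).
  move=> Ivr; apply: nLs; exists (v * u), (v * r); split=> //; first exact: WM.
  by rewrite !rmorphM -e; ring.
have Z0 := zero_ideal R.
have r1 := regular_mod_frac W1 WM hfrac hker Z0 reg1.
have r2 := regular_mod_frac W1 WM hfrac hker (adjoin_ideal a1 Z0) reg2.
have r3 := regular_mod_frac W1 WM hfrac hker (adjoin_ideal a2 (adjoin_ideal a1 Z0)) reg3.
rewrite (frac_ideal_adjoin W1 WM hinv hfrac _ (adjoin_ideal a1 Z0)) in r3.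
rewrite !(frac_ideal_adjoin W1 WM hinv hfrac _ Z0) !(frac_ideal0 W1 hinv) in r1 r2 r3.
have [x [y [z [genL rx ry rz]]]] := local_complete_intersection noeT locT
  (generates_frac W1 WM hinv hfrac Hf) (exact_mx_frac W1 WM hinv hfrac hker exD2)
  (exact_mx_frac W1 WM hinv hfrac hker exD3) (projective_frac W1 WM hinv hfrac hker noeR projD3)
  Ljac injL nLs socL simple faithful
  (frac_ideal_mem W1 h I1) (frac_ideal_mem W1 h I2) (frac_ideal_mem W1 h I3) r1 r2 r3.
have eL : L = adjoin (adjoin (adjoin [set 0] x) y) z.
  apply/seteqP; split=> t.
    move=> /genL[t1 [t2 [t3 ->]]]; exists (t1 * x + t2 * y), t3; split=> //.
    by apply/adjoin2P; exists t1, t2.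
  by move=> [_ [t3 [/adjoin2P[t1 [t2 ->]] ->]]]; apply/genL; exists t1, t2, t3.
exists [:: x; y; z]; split.
  by apply/regular_seq3P; split=> //; rewrite -eL.
have -> : localized_ideal I p = L by apply: frac_ideal_gen.
by rewrite eL -ideal_gen_nil -!ideal_gen_rcons.
Qed.

End Main.

Theorem theorem3p1 (R : comNzRingType) (I : idealr R) :
  gorenstein R ->
  perfect_gorenstein_codim3 I ->
  (generically_ci I <->
   ideal_colon (ideal_mul [set` I]%classic [set` I]%classic) [set` I]%classic
     = [set` I]%classic).
Proof.
move=> [/noetherian_fg_ideals noeR _] [_ [[[s [regs sI sz]] _] [pd _]] gorA].
case: s regs sI sz => [|a1 [|a2 [|a3 [|//]]]] // regs sI _.
have I1 : I a1 by apply: sI; rewrite /= inE eqxx.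
have I2 : I a2 by apply: sI; rewrite /= !inE eqxx orbT.
have I3 : I a3 by apply: sI; rewrite /= !inE eqxx !orbT.
split=> [ci|]; last exact: colon_generically_ci noeR gorA _ _ _ pd I1 I2 I3 regs.
have [reg1 _ _ _] := (proj1 (regular_seq3P a1 a2 a3)) regs.
apply/seteqP; split=> [x|x Ix b Ib]; last exact: ideal_mul_mem.
move=> colx; exact: (generically_ci_colon noeR gorA ci I1 reg1 colx).
Qed.
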